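(* Let $(M,H,\omega)$ be an almost hypercomplex skew-Hermitian manifold of dimension $4n$, $n>1$, with canonical connection $\nabla^{H,\omega}$. Then $H$ is hypercomplex (i.e. the three almost complex structures of $H$ are integrable) if and only if $(H,\omega)$ is of type $\mathcal{X}_{3457}$, that is, the components of the torsion of $\nabla^{H,\omega}$ in $\mathcal{X}_1=[\mathsf{K}S^3\mathsf{H}]^*$, $\mathcal{X}_2=[\Lambda^3\mathsf{E}\,S^3\mathsf{H}]^*$ and $\mathcal{X}_6=[\mathsf{E}\,S^3\mathsf{H}]^*$ vanish.
   Context: $M$ is a connected smooth $4n$-manifold, $n>1$. An almost hypercomplex structure is a triple $H=\{J_1,J_2,J_3\}$ of almost complex structures with $J_1J_2=-J_2J_1=J_3$. A scalar 2-form with respect to $H$ is a non-degenerate 2-form $\omega$ with $\omega(J_aX,J_aY)=\omega(X,Y)$, $a=1,2,3$; then $(H,\omega)$ is an almost hypercomplex skew-Hermitian structure (equivalently an $\mathsf{SO}^*(2n)$-structure). Modules (for $\mathsf{SO}^*(2n)\mathsf{Sp}(1)$): $\mathsf{E}=\mathbb{C}^{2n}$, $\mathsf{H}=\mathbb{C}^2$ are the standard representations of $\mathsf{SO}^*(2n)$, $\mathsf{Sp}(1)$; $[\,\cdot\,]$ denotes the real form; $T_xM\cong[\mathsf{EH}]$. $\mathsf{E}$ carries an invariant complex symmetric form; $S^k_0\mathsf{E}$ denotes trace-free symmetric tensors. $\mathsf{E}\otimes\Lambda^2\mathsf{E}=\Lambda^3\mathsf{E}\oplus\mathsf{K}\oplus\mathsf{E}$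 (totally skew part; kernel $\mathsf{K}$ of total antisymmetrization and trace; pure trace part), and $\mathsf{E}\otimes S^2_0\mathsf{E}\cong S^3_0\mathsf{E}\oplus\mathsf{K}\oplus\mathsf{E}$. In $\Lambda^2[\mathsf{EH}]^*\otimes[\mathsf{EH}]$ the $S^3\mathsf{H}$-isotypic part for $\mathsf{Sp}(1)$ is $[(\mathsf{E}\otimes\Lambda^2\mathsf{E})S^3\mathsf{H}]^*=[\mathsf{K}S^3\mathsf{H}]^*\oplus[\Lambda^3\mathsf{E}S^3\mathsf{H}]^*\oplus[\mathsf{E}S^3\mathsf{H}]^*=:\mathcal{X}_1\oplus\mathcal{X}_2\oplus\mathcal{X}_6$. Identify $[S^2_0\mathsf{E}]^*$ with the trace-free endomorphisms $B$ commuting with all $J_a$ for which $\omega(B\cdot,\cdot)$ is skew. With $\delta(A)(X,Y)=A(X,Y)-A(Y,X)$, the images under $\delta$ of the components $[\mathsf{KH}]^*,[\mathsf{EH}]^*,[S^3_0\mathsf{EH}]^*$ of $[\mathsf{EH}]^*\otimes[S^2_0\mathsf{E}]^*$ are $\mathcal{X}_3,\mathcal{X}_4,\mathcal{X}_5$. With $\pi_\omega(T)(X,Y,Z)=\mathfrak{S}_{X,Y,Z}\,\omega(T(X,Y),Z)$ (cyclic sum), $\mathcal{X}_7\cong[\mathsf{EH}]^*$ is the intersection of $\ker\pi_\omega$ with $\mathcal{X}_4\oplus\delta([\mathsf{EH}]^*\otimes\mathrm{Id})$. Write $\mathcal{X}_{i_1\ldots i_j}=\mathcal{X}_{i_1}\oplus\cdots\oplus\mathcal{X}_{i_j}$.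 Connections: the Obata connection $\nabla^H$ is the unique connection preserving $H$ with torsion $T^H=\frac16(N_{J_1}+N_{J_2}+N_{J_3})$, where $N_J(X,Y)=[JX,JY]-[X,Y]-J[JX,Y]-J[X,JY]$ (equivalently, its torsion lies in $\mathcal{X}_{126}$). The canonical connection is $\nabla^{H,\omega}=\nabla^H+A$, with $\omega(A(X,Y),Z)=\frac12(\nabla^H_X\omega)(Y,Z)$; it preserves $H$ and $\omega$ and its torsion takes values in $\mathcal{X}_{1234567}$. $(H,\omega)$ is of type $\mathcal{X}_{i_1\ldots i_j}$ if the torsion of $\nabla^{H,\omega}$ takes values in $\mathcal{X}_{i_1\ldots i_j}$. *)

(* Defs.v *)
From HB Require Import structures.
From mathcomp Require Import all_boot all_order all_algebra.
From mathcomp Require Import all_classical all_reals all_analysis.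
From mathcomp Require Import complex.
Set Implicit Arguments.
Unset Strict Implicit.
Unset Printing Implicit Defensive.
Import Order.TTheory GRing.Theory Num.Theory.
Import numFieldNormedType.Exports.
Local Open Scope classical_set_scope.
Local Open Scope ring_scope.
Local Open Scope complex_scope.

(* Smooth maps between (subsets of) normed spaces: all iterated directional
   derivatives exist and are continuous. *)

Definition iter_derive (R : realType) (m : nat) (V : normedModType R)
    (vs : seq 'cV[R]_m) (f : 'cV[R]_m -> V) : 'cV[R]_m -> V :=
  foldr (fun v (g : 'cV[R]_m -> V) (x : 'cV[R]_m) => 'D_v g x) f vs.

Definition smooth_on (R : realType) (m : nat) (V : normedModType R)
    (U : set 'cV[R]_m) (f : 'cV[R]_m -> V) : Prop :=
  forall (vs : seq 'cV[R]_m) (x : 'cV[R]_m), U x ->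
    {for x, continuous (iter_derive vs f)} /\
    forall v : 'cV[R]_m, derivable (iter_derive vs f) x v.

(* Smooth manifolds of dimension m.  [coord i] is only meaningful on [dom i]
   and [param i], its inverse, on the open set [coord i @` dom i]. *)

Record smooth_manifold (R : realType) (m : nat) := SmoothManifold {
  points :> topologicalType;
  charts : Type;
  dom : charts -> set points;
  coord : charts -> points -> 'cV[R]_m;
  param : charts -> 'cV[R]_m -> points;
  manifold_hausdorff : hausdorff_space points;
  manifold_second_countable : @second_countable points;
  dom_open : forall i : charts, open (dom i);
  dom_cover : forall p : points, exists i : charts, dom i p;
  coord_open : forall i : charts, open (coord i @` dom i);
  coordK : forall (i : charts) (p : points), dom i p -> param i (coord i p) = p;
  coord_continuous : forall i : charts, {within dom i, continuous (coord i)};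
  param_continuous : forall i : charts,
    {within coord i @` dom i, continuous (param i)};
  transition_smooth : forall i j : charts,
    smooth_on (coord i @` (dom i `&` dom j)) (fun x => coord j (param i x))
}.

Section Geometry.
Context {R : realType} {m : nat}.

Section Fields.
Variable M : smooth_manifold R m.

Definition img (i : charts M) : set 'cV[R]_m := coord i @` dom i.

Definition overlap (i j : charts M) : set 'cV[R]_m :=
  coord i @` (dom i `&` dom j).

Definition transition (i j : charts M) (x : 'cV[R]_m) : 'cV[R]_m :=
  coord j (param i x).

(* Tensor fields are given by their components in each chart; [x] ranges over
   the chart image, and the differential of the transition map at [x] is
   u |-> 'D_u (transition i j) x. *)

Definition formv (w : 'M[R]_m) (u v : 'cV[R]_m) : R := (u^T *m w *m v) 0 0.

Definition endo_field := charts M -> 'cV[R]_m -> 'M[R]_m.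

Definition is_endo_field (J : endo_field) : Prop :=
  (forall i : charts M, smooth_on (img i) (J i)) /\
  (forall (i j : charts M) (x u : 'cV[R]_m), overlap i j x ->
     'D_(J i x *m u) (transition i j) x =
     J j (transition i j x) *m 'D_u (transition i j) x).

Definition is_2form (w : charts M -> 'cV[R]_m -> 'M[R]_m) : Prop :=
  [/\ forall i : charts M, smooth_on (img i) (w i),
      forall (i : charts M) (x u v : 'cV[R]_m), img i x ->
        formv (w i x) u v = - formv (w i x) v u
    & forall (i j : charts M) (x u v : 'cV[R]_m), overlap i j x ->
        formv (w j (transition i j x))
          ('D_u (transition i j) x) ('D_v (transition i j) x) =
        formv (w i x) u v].

Definition almost_complex (J : endo_field) : Prop :=
  is_endo_field J /\
  forall (i : charts M) (x : 'cV[R]_m), img i x -> J i x *m J i x = - 1%:M.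

(* (J_1, J_2, J_3) is (J 0, J 1, J 2); indices in 'I_3 are taken mod 3. *)
Definition almost_hypercomplex (J : 'I_3 -> endo_field) : Prop :=
  (forall a : 'I_3, almost_complex (J a)) /\
  forall (i : charts M) (x : 'cV[R]_m), img i x ->
    J 0 i x *m J 1 i x = J 2 i x /\ - (J 1 i x *m J 0 i x) = J 2 i x.

Definition scalar_2form (J : 'I_3 -> endo_field)
    (w : charts M -> 'cV[R]_m -> 'M[R]_m) : Prop :=
  [/\ is_2form w,
      forall (i : charts M) (x : 'cV[R]_m), img i x -> w i x \in unitmx
    & forall (a : 'I_3) (i : charts M) (x u v : 'cV[R]_m), img i x ->
        formv (w i x) (J a i x *m u) (J a i x *m v) = formv (w i x) u v].

(* Christoffel symbols: [G i x u v] is the covariant derivative at [x], in the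
   direction [u], of the vector field with constant components [v] in chart i. *)

Definition christoffel :=
  charts M -> 'cV[R]_m -> 'cV[R]_m -> 'cV[R]_m -> 'cV[R]_m.

Definition bilinear2 (t : 'cV[R]_m -> 'cV[R]_m -> 'cV[R]_m) : Prop :=
  (forall (a : R) (u u' v : 'cV[R]_m), t (a *: u + u') v = a *: t u v + t u' v) /\
  (forall (a : R) (u v v' : 'cV[R]_m), t u (a *: v + v') = a *: t u v + t u v').

Definition is_connection (G : christoffel) : Prop :=
  [/\ forall (i : charts M) (x : 'cV[R]_m), img i x -> bilinear2 (G i x),
      forall (i : charts M) (u v : 'cV[R]_m),
        smooth_on (img i) (fun x => G i x u v)
    & forall (i j : charts M) (x u v : 'cV[R]_m), overlap i j x ->
        'D_(G i x u v) (transition i j) x =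
        'D_u (fun y : 'cV[R]_m => 'D_v (transition i j) y) x +
        G j (transition i j x)
          ('D_u (transition i j) x) ('D_v (transition i j) x)].

End Fields.

(* Below, X, Y, Z are the components, in one chart, of vector fields defined on
   the domain of that chart. *)

Definition bracket (X Y : 'cV[R]_m -> 'cV[R]_m) (x : 'cV[R]_m) : 'cV[R]_m :=
  'D_(X x) Y x - 'D_(Y x) X x.

Definition app_endo (J : 'cV[R]_m -> 'M[R]_m) (X : 'cV[R]_m -> 'cV[R]_m)
  (x : 'cV[R]_m) : 'cV[R]_m := J x *m X x.

Definition nijenhuis (J : 'cV[R]_m -> 'M[R]_m) (X Y : 'cV[R]_m -> 'cV[R]_m)
    (x : 'cV[R]_m) : 'cV[R]_m :=
  bracket (app_endo J X) (app_endo J Y) x - bracket X Y x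
  - J x *m bracket (app_endo J X) Y x - J x *m bracket X (app_endo J Y) x.

Definition cov (G : 'cV[R]_m -> 'cV[R]_m -> 'cV[R]_m -> 'cV[R]_m)
    (X Y : 'cV[R]_m -> 'cV[R]_m) (x : 'cV[R]_m) : 'cV[R]_m :=
  'D_(X x) Y x + G x (X x) (Y x).

Definition torsion (G : 'cV[R]_m -> 'cV[R]_m -> 'cV[R]_m -> 'cV[R]_m)
    (X Y : 'cV[R]_m -> 'cV[R]_m) (x : 'cV[R]_m) : 'cV[R]_m :=
  cov G X Y x - cov G Y X x - bracket X Y x.

(* (nabla_X w)(Y, Z) *)
Definition cov_form (G : 'cV[R]_m -> 'cV[R]_m -> 'cV[R]_m -> 'cV[R]_m)
    (w : 'cV[R]_m -> 'M[R]_m) (X Y Z : 'cV[R]_m -> 'cV[R]_m)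
    (x : 'cV[R]_m) : R :=
  'D_(X x) (fun y : 'cV[R]_m => formv (w y) (Y y) (Z y)) x
  - formv (w x) (cov G X Y x) (Z x) - formv (w x) (Y x) (cov G X Z x).

(* The torsion tensor at [x]: the torsion of the vector fields with constant
   components u and v. *)
Definition torsion_at (G : 'cV[R]_m -> 'cV[R]_m -> 'cV[R]_m -> 'cV[R]_m)
    (x u v : 'cV[R]_m) : 'cV[R]_m :=
  torsion G (fun _ => u) (fun _ => v) x.

Section Structures.
Variable M : smooth_manifold R m.

(* Integrability as vanishing of the Nijenhuis torsion (Kobayashi-Nomizu); by
   Newlander-Nirenberg this is the existence of holomorphic charts. *)
Definition integrable_acs (J : endo_field M) : Prop :=
  forall (i : charts M) (X Y : 'cV[R]_m -> 'cV[R]_m),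
    smooth_on (img i) X -> smooth_on (img i) Y ->
    forall x : 'cV[R]_m, img i x -> nijenhuis (J i) X Y x = 0.

Definition hypercomplex (J : 'I_3 -> endo_field M) : Prop :=
  forall a : 'I_3, integrable_acs (J a).

Definition preserves_endo (G : christoffel M) (J : endo_field M) : Prop :=
  forall (i : charts M) (X Y : 'cV[R]_m -> 'cV[R]_m),
    smooth_on (img i) X -> smooth_on (img i) Y ->
    forall x : 'cV[R]_m, img i x ->
      cov (G i) X (app_endo (J i) Y) x = J i x *m cov (G i) X Y x.

Definition obata_connection (J : 'I_3 -> endo_field M) (G : christoffel M) :
    Prop :=
  [/\ is_connection G,
      forall a : 'I_3, preserves_endo G (J a)
    & forall (i : charts M) (X Y : 'cV[R]_m -> 'cV[R]_m),
        smooth_on (img i) X -> smooth_on (img i) Y ->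
        forall x : 'cV[R]_m, img i x ->
          torsion (G i) X Y x =
          6^-1 *: \sum_(a < 3) nijenhuis (J a i) X Y x].

Definition canonical_connection (J : 'I_3 -> endo_field M)
    (w : charts M -> 'cV[R]_m -> 'M[R]_m) (G : christoffel M) : Prop :=
  is_connection G /\
  exists2 GH : christoffel M, obata_connection J GH &
    forall (i : charts M) (X Y Z : 'cV[R]_m -> 'cV[R]_m),
      smooth_on (img i) X -> smooth_on (img i) Y -> smooth_on (img i) Z ->
      forall x : 'cV[R]_m, img i x ->
        formv (w i x) (cov (G i) X Y x - cov (GH i) X Y x) (Z x) =
        2^-1 * cov_form (GH i) (w i) X Y Z x.

End Structures.

End Geometry.

(* The modules X_1, ..., X_7 at one point: V = R^(4n), J : 'I_3 -> 'M_(4n)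
   satisfies the quaternion relations and w is the Gram matrix of a scalar
   2-form.

   V (x) C is identified with E (x) H as follows: E is the i-eigenspace of J_1,
   and for e in E the tensor e (x) (h1, h2) is the vector h1 e + h2 J_2 e.  Then
   J_1, J_2, J_3 (that is, J 0, J 1, J 2) act on the factor H = C^2 alone, through the standard
   representation of sp(1), and
     w (e (x) h, e' (x) h') = gE e e' * eps h h'
   where gE is symmetric on E and eps is the area form of H.  *)

Section Modules.
Context {R : realType} {n : nat}.
Local Notation C := R[i].
Local Notation V := 'cV[R]_(4 * n).
Local Notation VC := 'cV[C]_(4 * n).
Implicit Types (t A : V -> V -> V).

Definition cplx {p q : nat} (A : 'M[R]_(p, q)) : 'M[C]_(p, q) :=
  map_mx (real_complex R) A.

Definition imC : C := Complex 0 1.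

Definition re_part (z : VC) : V := map_mx (@complex.Re R) z.
Definition im_part (z : VC) : V := map_mx (@complex.Im R) z.

(* Complex bilinear extension. *)
Definition ext2 t (z z' : VC) : VC :=
  cplx (t (re_part z) (re_part z') - t (im_part z) (im_part z'))
  + imC *: cplx (t (re_part z) (im_part z') + t (im_part z) (re_part z')).

Variables (J : 'I_3 -> 'M[R]_(4 * n)) (w : 'M[R]_(4 * n)).

Definition formC (z z' : VC) : C := (z^T *m cplx w *m z') 0 0.

Definition inE1 (e : VC) : Prop := cplx (J 0) *m e = imC *: e.

Definition eh (e : VC) (h : C * C) : VC :=
  h.1 *: e + h.2 *: (cplx (J 1) *m e).

Definition gE (e e' : VC) : C := formC e (cplx (J 1) *m e').

(* A pair of gE-dual bases of E (which has complex dimension 2n); traces over E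
   are computed with these. *)
Definition dual_bases (b b' : 'I_(2 * n) -> VC) : Prop :=
  [/\ forall k, inE1 (b k), forall k, inE1 (b' k)
    & forall k l, gE (b k) (b' l) = (k == l)%:R].

(* The 3-tensor w(t(X, Y), Z), with X = e1 (x) h1, Y = e2 (x) h2 and
   Z = e3 (x) h3. *)
Definition lower t (e1 : VC) (h1 : C * C) (e2 : VC) (h2 : C * C)
    (e3 : VC) (h3 : C * C) : C :=
  formC (ext2 t (eh e1 h1) (eh e2 h2)) (eh e3 h3).

Definition skew2 t : Prop :=
  bilinear2 t /\ forall u v : V, t u v = - t v u.

(* [(E (x) Lambda^2 E) S^3 H]^*: the skew tensors that are symmetric in the
   H-arguments. *)
Definition S3H_part t : Prop :=
  skew2 t /\
  forall (e1 e2 e3 : VC) (h1 h2 h3 : C * C), inE1 e1 -> inE1 e2 -> inE1 e3 ->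
    lower t e1 h1 e2 h2 e3 h3 = lower t e1 h2 e2 h1 e3 h3 /\
    lower t e1 h1 e2 h2 e3 h3 = lower t e1 h1 e2 h3 e3 h2.

(* [K S^3H]^*: the form below being already skew in e1, e2, its total
   antisymmetrization over E is its cyclic sum. *)
Definition X1 t : Prop :=
  [/\ S3H_part t,
      forall (e1 e2 e3 : VC) (h1 h2 h3 : C * C),
        inE1 e1 -> inE1 e2 -> inE1 e3 ->
        lower t e1 h1 e2 h2 e3 h3 + lower t e2 h1 e3 h2 e1 h3
        + lower t e3 h1 e1 h2 e2 h3 = 0
    & forall (b b' : 'I_(2 * n) -> VC) (e : VC) (h1 h2 h3 : C * C),
        dual_bases b b' -> inE1 e ->
        \sum_(k < 2 * n) lower t (b k) h1 e h2 (b' k) h3 = 0].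

(* [Lambda^3E S^3H]^* *)
Definition X2 t : Prop :=
  S3H_part t /\
  forall (e1 e2 e3 : VC) (h1 h2 h3 : C * C), inE1 e1 -> inE1 e2 -> inE1 e3 ->
    lower t e1 h1 e2 h2 e3 h3 = - lower t e1 h1 e3 h2 e2 h3.

(* [E S^3H]^*: pure traces *)
Definition X6 t : Prop :=
  S3H_part t /\
  exists theta : VC -> C * C -> C * C -> C * C -> C,
    forall (e1 e2 e3 : VC) (h1 h2 h3 : C * C), inE1 e1 -> inE1 e2 -> inE1 e3 ->
      lower t e1 h1 e2 h2 e3 h3 =
      gE e1 e3 * theta e2 h1 h2 h3 - gE e2 e3 * theta e1 h1 h2 h3.

Definition delta A : V -> V -> V := fun u v => A u v - A v u.

(* [EH]^* (x) [S^2_0 E]^* *)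
Definition EH_S20E A : Prop :=
  [/\ bilinear2 A,
      forall (a : 'I_3) (u v : V), A u (J a *m v) = J a *m A u v,
      forall u v v' : V, formv w (A u v) v' = - formv w (A u v') v
    & forall u : V, \sum_(k < 4 * n) A u (delta_mx k 0) k 0 = 0].

(* For A in EH_S20E,
     lower A e1 h e2 h2 e3 h3 = symb A e1 h e2 e3 * eps h2 h3,
   with symb A e1 h e2 e3 symmetric and trace-free in e2, e3. *)
Definition symb A (e1 : VC) (h : C * C) (e2 e3 : VC) : C :=
  lower A e1 h e2 (1, 0) e3 (0, 1).

(* [KH]^* *)
Definition KH A : Prop :=
  [/\ EH_S20E A,
      forall (e1 e2 e3 : VC) (h : C * C), inE1 e1 -> inE1 e2 -> inE1 e3 ->
        symb A e1 h e2 e3 + symb A e2 h e3 e1 + symb A e3 h e1 e2 = 0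
    & forall (b b' : 'I_(2 * n) -> VC) (e : VC) (h : C * C),
        dual_bases b b' -> inE1 e ->
        \sum_(k < 2 * n) symb A (b k) h (b' k) e = 0].

Definition covec (xi : 'rV[R]_(4 * n)) (u : V) : R := (xi *m u) 0 0.

Definition covecC (xi : 'rV[R]_(4 * n)) (z : VC) : C := (cplx xi *m z) 0 0.

(* [EH]^*: the trace-free (in e2, e3) pure traces *)
Definition EH A : Prop :=
  EH_S20E A /\
  exists xi : 'rV[R]_(4 * n),
    forall (e1 e2 e3 : VC) (h : C * C), inE1 e1 -> inE1 e2 -> inE1 e3 ->
      symb A e1 h e2 e3 =
      gE e1 e2 * covecC xi (eh e3 h) + gE e1 e3 * covecC xi (eh e2 h)
      - n%:R^-1 * gE e2 e3 * covecC xi (eh e1 h).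

(* [S^3_0 E H]^* *)
Definition S30EH A : Prop :=
  EH_S20E A /\
  forall (e1 e2 e3 : VC) (h : C * C), inE1 e1 -> inE1 e2 -> inE1 e3 ->
    symb A e1 h e2 e3 = symb A e2 h e1 e3.

Definition image_delta (P : (V -> V -> V) -> Prop) t : Prop :=
  exists2 A, P A & forall u v : V, t u v = delta A u v.

Definition pi_form t (u v v' : V) : R :=
  formv w (t u v) v' + formv w (t v v') u + formv w (t v' u) v.

Definition X7 t : Prop :=
  (exists (t4 : V -> V -> V) (xi : 'rV[R]_(4 * n)),
     image_delta EH t4 /\
     forall u v : V, t u v = t4 u v + delta (fun u v => covec xi u *: v) u v) /\
  forall u v v' : V, pi_form t u v v' = 0.

Definition X_ (k : nat) : (V -> V -> V) -> Prop :=
  match k with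
  | 1 => X1
  | 2 => X2
  | 3 => image_delta KH
  | 4 => image_delta EH
  | 5 => image_delta S30EH
  | 6 => X6
  | 7 => X7
  | _ => fun t => forall u v : V, t u v = 0
  end.

(* s is a decomposition of t along the sum of the X_k, k in I. *)
Definition decomposition (I : seq nat) (s : nat -> V -> V -> V) t : Prop :=
  (forall k, k \in I -> X_ k (s k)) /\
  forall u v : V, t u v = \sum_(k <- I) s k u v.

Definition in_sum (I : seq nat) t : Prop :=
  exists s : nat -> V -> V -> V, decomposition I s t.

(* c is the component of t in X_k, with respect to X_1 + ... + X_7. *)
Definition component (k : nat) t (c : V -> V -> V) : Prop :=
  exists2 s : nat -> V -> V -> V, decomposition (iota 1 7) s t & s k = c.

End Modules.

Section Types.
Context {R : realType} {n : nat}.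
Variable M : smooth_manifold R (4 * n).
Variables (J : 'I_3 -> endo_field M)
  (w : charts M -> 'cV[R]_(4 * n) -> 'M[R]_(4 * n)) (G : christoffel M).

(* G is meant to be the canonical connection of (J, w). *)

Definition of_type (I : seq nat) : Prop :=
  forall (i : charts M) (x : 'cV[R]_(4 * n)), img i x ->
    in_sum (fun a => J a i x) (w i x) I (torsion_at (G i) x).

Definition torsion_component_vanishes (k : nat) : Prop :=
  forall (i : charts M) (x : 'cV[R]_(4 * n)), img i x ->
    component (fun a => J a i x) (w i x) k (torsion_at (G i) x)
      (fun _ _ => 0).

End Types.

(* Main.v *)
(* If a connection preserves J_a, its torsion T determines the Nijenhuis tensor
   of J_a algebraically, and T = delta B gives zero whenever the endomorphisms
   B(u, .) commute with J_a.  All elements of X_3, X_4, X_5 and X_7 are of the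
   form delta B with B(u, .) commuting with J_1, J_2, J_3, so type X_3457 implies
   integrability.

   Conversely, if H is hypercomplex the Obata connection is torsion-free, so the
   torsion of the canonical connection is delta A, where A(u, .) commutes with
   the J_a and is skew for w.  Split off the trace, A = A_0 + xi (x) Id, then the
   E-trace of A_0, then its totally E-symmetric part; this gives the components
   in X_4, X_5 and X_3, while delta (xi (x) Id), corrected by the element of X_4
   with covector n / (n + 1) xi, lies in X_7.

   A tensor delta B as above which is totally symmetric in the H-arguments
   vanishes, so the sum X_1 + X_2 + X_6 meets X_3457 trivially; X_1, X_2 and X_6
   are separated by total antisymmetrization and by the trace over E. *)

(* The modules are described by conditions on E, which exists only inside V (x) C, while every
   component of the torsion has to be a real tensor. The two projections of the converse, onto the
   E-trace part and onto the totally E-symmetric part, are therefore written first as real formulas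
   in [w] and the [J a] ([traceE], [swapE]), and only afterwards extended to V (x) C and evaluated
   on decomposable vectors, where they become the expected tensors over E.

   Trace conditions quantify over all pairs of dual bases of E. They are controlled by rewriting an
   E-trace as an ordinary contraction over V, which depends on no choice and shows that the trace of
   a real tensor is given by a real covector.

   A component is taken with respect to some decomposition, so the vanishing of three components may
   be witnessed by three different decompositions. This is why the parts in X_1, X_2 and X_6 must be
   shown to be unique. *)
Require Import Defs.
From mathcomp Require Import all_boot all_order all_algebra.
From mathcomp Require Import all_classical all_reals all_analysis.
From mathcomp Require Import complex ring.
Set Implicit Arguments.
Unset Strict Implicit.
Unset Printing Implicit Defensive.
Import Order.TTheory GRing.Theory Num.Theory.
Import numFieldNormedType.Exports.
Local Open Scope classical_set_scope.
Local Open Scope ring_scope.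

(* Several scalar-valued expressions are locked: over the complex numbers,
   testing the convertibility of two distinct values of the unlocked definitions
   unfolds matrix products. *)
Fact lock_key : unit. Proof. exact: tt. Qed.

(** * Linear, bilinear and trilinear forms on column vectors, and index raising *)

Section LinearForms.
Variables (K : numFieldType) (m : nat).
Implicit Types (x y z : 'cV[K]_m).

Definition lform (f : 'cV[K]_m -> K) :=
  forall a x y, f (a *: x + y) = a * f x + f y.

Definition tform (L : 'cV[K]_m -> 'cV[K]_m -> 'cV[K]_m -> K) :=
  [/\ forall y z, lform (fun x => L x y z), forall x z, lform (fun y => L x y z)
    & forall x y, lform (L x y)].

Section OneForm.
Variables (f : 'cV[K]_m -> K) (hf : lform f).

Lemma lformD x y : f (x + y) = f x + f y.
Proof. by rewrite -[x]scale1r hf mul1r scale1r. Qed.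

Lemma lform0 : f 0 = 0.
Proof. by apply: (addrI (f 0)); rewrite -lformD !addr0. Qed.

Lemma lformZ a x : f (a *: x) = a * f x.
Proof. by rewrite -[a *: x]addr0 hf lform0 addr0. Qed.

Lemma lformN x : f (- x) = - f x.
Proof. by rewrite -scaleN1r lformZ mulN1r. Qed.

Lemma lformE : (forall x y, f (x + y) = f x + f y) *
  (forall a x, f (a *: x) = a * f x) * (forall x, f (- x) = - f x) * (f 0 = 0).
Proof. exact: (lformD, lformZ, lformN, lform0). Qed.

Lemma lform_sum n (F : 'I_n -> 'cV[K]_m) :
  f (\sum_(i < n) F i) = \sum_(i < n) f (F i).
Proof. by apply: (big_morph f lformD lform0). Qed.

Lemma lform_coord x : f x = \sum_(j < m) x j 0 * f (delta_mx j 0).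
Proof.
rewrite {1}(matrix_sum_delta x) lform_sum; apply: eq_bigr => j _.
by rewrite big_ord1 lformZ.
Qed.

End OneForm.

Definition rform : 'rV[K]_m -> 'cV[K]_m -> K :=
  locked_with lock_key (fun xi x => (xi *m x) 0 0).

Lemma rformE xi x : rform xi x = (xi *m x) 0 0.
Proof. by rewrite /rform unlock. Qed.

Lemma rform_lform xi : lform (rform xi).
Proof. by move=> a x y; rewrite !rformE mulmxDr -scalemxAr !mxE. Qed.

Lemma lform_rform f : lform f -> forall x, rform (\row_j f (delta_mx j 0)) x = f x.
Proof.
move=> hf x; rewrite (lform_coord hf) rformE !mxE; apply: eq_bigr => j _.
by rewrite mxE mulrC.
Qed.

Section BilinearForm.
Variable W : 'M[K]_m.

Definition bform : 'cV[K]_m -> 'cV[K]_m -> K :=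
  locked_with lock_key (fun x y => (x^T *m W *m y) 0 0).

Lemma bform_mx x y : bform x y = (x^T *m W *m y) 0 0.
Proof. by rewrite /bform unlock. Qed.

Lemma bform_col p q (A : 'M[K]_(m, p)) (B : 'M[K]_(m, q)) k l :
  (A^T *m W *m B) k l = bform (col k A) (col l B).
Proof.
rewrite bform_mx tr_col -row_mul mxE [RHS]mxE.
by apply: eq_bigr => j _; rewrite !mxE.
Qed.

Lemma bform_l y : lform (bform^~ y).
Proof.
by move=> a x x'; rewrite !bform_mx linearP /= !mulmxDl -!scalemxAl !mxE.
Qed.

Lemma bform_r x : lform (bform x).
Proof. by move=> a y y'; rewrite !bform_mx mulmxDr -scalemxAr !mxE. Qed.

Lemma bformE : (forall x y z, bform (x + y) z = bform x z + bform y z) *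
  (forall a x z, bform (a *: x) z = a * bform x z) *
  (forall x z, bform (- x) z = - bform x z) *
  (forall x y z, bform z (x + y) = bform z x + bform z y) *
  (forall a x z, bform z (a *: x) = a * bform z x) *
  (forall x z, bform z (- x) = - bform z x).
Proof.
do !split; move=> *;
  by rewrite (lformE (@bform_l _)) || rewrite (lformE (@bform_r _)).
Qed.

(** Index raising, in the convention where the representing vector fills the first slot of
    [bform]. *)
Definition sharp (f : 'cV[K]_m -> K) : 'cV[K]_m :=
  (\row_j f (delta_mx j 0) *m invmx W)^T.

Hypothesis Wunit : W \in unitmx.

Lemma bform_sharp f x : lform f -> bform (sharp f) x = f x.
Proof.
by move=> hf; rewrite bform_mx /sharp trmxK mulmxKV // -[RHS](lform_rform hf) rformE.
Qed.

Lemma bform_inj x y : (forall z, bform x z = bform y z) -> x = y.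
Proof.
move=> h; apply: trmx_inj; apply: (can_inj (mulmxK Wunit)).
apply/rowP => j; have := h (delta_mx j 0).
by rewrite !bform_mx -!colE !mxE.
Qed.

End BilinearForm.
End LinearForms.

(** * Quaternionic linear algebra, over a general field so that it serves both V and V (x) C *)

Section Quaternionic.
Variables (K : numFieldType) (m : nat) (J : 'I_3 -> 'M[K]_m) (W : 'M[K]_m).
Local Notation V := 'cV[K]_m.
Local Notation b := (bform W).

Definition quaternionic :=
  [/\ forall a, J a *m J a = - 1%:M, J 0 *m J 1 = J 2 & J 1 *m J 0 = - J 2].

Definition skew_hermitian :=
  (forall x y : V, b x y = - b y x) /\
  (forall a (x y : V), b (J a *m x) (J a *m y) = b x y).

Lemma forall_I3 (P : 'I_3 -> Prop) : P 0 -> P 1 -> P 2 -> forall a, P a.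
Proof.
move=> P0 P1 P2 [[|[|[|//]]] i]; [move: P0|move: P1|move: P2];
  by congr P; apply/val_inj.
Qed.

Hypotheses (hJ : quaternionic) (hW : skew_hermitian).

Lemma JK a (x : V) : J a *m (J a *m x) = - x.
Proof. by case: hJ => h _ _; rewrite mulmxA h mulNmx mul1mx. Qed.

Lemma quatE : (forall x : V, J 0 *m (J 1 *m x) = J 2 *m x) *
  (forall x : V, J 1 *m (J 0 *m x) = - (J 2 *m x)) *
  (forall x : V, J 0 *m (J 2 *m x) = - (J 1 *m x)) *
  (forall x : V, J 2 *m (J 0 *m x) = J 1 *m x) *
  (forall x : V, J 1 *m (J 2 *m x) = J 0 *m x) *
  (forall x : V, J 2 *m (J 1 *m x) = - (J 0 *m x)) *
  (forall a (x : V), J a *m (J a *m x) = - x).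
Proof.
have h01 (x : V) : J 0 *m (J 1 *m x) = J 2 *m x.
  by case: hJ => _ h _; rewrite mulmxA h.
have h10 (x : V) : J 1 *m (J 0 *m x) = - (J 2 *m x).
  by case: hJ => _ _ h; rewrite mulmxA h mulNmx.
have h02 (x : V) : J 0 *m (J 2 *m x) = - (J 1 *m x) by rewrite -h01 JK.
have h21 (x : V) : J 2 *m (J 1 *m x) = - (J 0 *m x).
  by rewrite -h01 JK mulmxN.
have h20 (x : V) : J 2 *m (J 0 *m x) = J 1 *m x.
  by rewrite -h01 h10 mulmxN h02 opprK.
have h12 (x : V) : J 1 *m (J 2 *m x) = J 0 *m x.
  by rewrite -[J 2 *m x]opprK -h10 mulmxN JK opprK.
do !split => //; exact: JK.
Qed.

Lemma bJl a x y : b (J a *m x) y = - b x (J a *m y).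
Proof. by case: hW => _ h; rewrite -(h a x) JK !bformE opprK. Qed.

Lemma bJsym a x y : b x (J a *m y) = b y (J a *m x).
Proof. by case: hW => h _; rewrite [LHS]h bJl opprK. Qed.

(* If L x (J_a y) z = - L x y (J_a z), this exchanges the E-parts of the first
   two arguments of L: the sum of the J_a (x) J_a acts on H (x) H as 1 - 2 P,
   with P the flip. *)
Definition swapE (L : V -> V -> V -> K) x y z : K :=
  2^-1 * (L y x z + L (J 0 *m y) x (J 0 *m z) + L (J 1 *m y) x (J 1 *m z)
          + L (J 2 *m y) x (J 2 *m z)).

(** Symmetrization over the three E-arguments of a form that is already symmetric in the last two.
    The minus sign compensates for eps, which changes sign when [y] and [z] are exchanged. *)
Definition symE (L : V -> V -> V -> K) x y z : K :=
  3^-1 * (L x y z + swapE L x y z - swapE L x z y).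

Lemma mulmx_lcomb (A : 'M[K]_m) a (x y : V) : A *m (a *: x + y) = a *: (A *m x) + A *m y.
Proof. by rewrite mulmxDr -scalemxAr. Qed.

Lemma mulmx_colE : (forall (A : 'M[K]_m) (x y : V), A *m (x + y) = A *m x + A *m y) *
  (forall (A : 'M[K]_m) a (x : V), A *m (a *: x) = a *: (A *m x)) *
  (forall (A : 'M[K]_m) (x : V), A *m (- x) = - (A *m x)).
Proof. by do !split; move=> *; rewrite (mulmxDr, mulmxN, =^~ scalemxAr). Qed.

Section Swap.
Variable L : V -> V -> V -> K.
Hypotheses (hL : tform L) (LJ : forall a x y z, L x (J a *m y) z = - L x y (J a *m z)).

Lemma tformE : (forall x y z z', L (x + y) z z' = L x z z' + L y z z') *
  (forall a x z z', L (a *: x) z z' = a * L x z z') *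
  (forall x z z', L (- x) z z' = - L x z z') *
  (forall x y z z', L z (x + y) z' = L z x z' + L z y z') *
  (forall a x z z', L z (a *: x) z' = a * L z x z') *
  (forall x z z', L z (- x) z' = - L z x z') *
  (forall x y z z', L z z' (x + y) = L z z' x + L z z' y) *
  (forall a x z z', L z z' (a *: x) = a * L z z' x) *
  (forall x z z', L z z' (- x) = - L z z' x).
Proof.
case: hL => h1 h2 h3.
do !split; move=> *;
  by rewrite (lformE (h1 _ _)) || rewrite (lformE (h2 _ _)) || rewrite (lformE (h3 _ _)).
Qed.

Lemma swapE_tform : tform (swapE L).
Proof.
case: hL => h1 h2 h3; split=> u v a x y;
  by rewrite /swapE !(mulmx_lcomb, h1, h2, h3); ring.
Qed.

Lemma symE_tform : tform (symE L).
Proof.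
case: hL => h1 h2 h3; have [s1 s2 s3] := swapE_tform.
by split=> u v a x y; rewrite /symE !(h1, h2, h3, s1, s2, s3); ring.
Qed.

(** Left multiplication by a quaternion unit permutes 1, [J 0], [J 1], [J 2] up to sign, hence also
    the four terms of [swapE]. *)
Lemma swapEJ a x y z : swapE L x (J a *m y) z = - swapE L x y (J a *m z).
Proof.
by move: a; apply: forall_I3; rewrite /swapE !quatE !tformE; ring.
Qed.

Lemma symEJ a x y z : symE L x (J a *m y) z = - symE L x y (J a *m z).
Proof.
have h u v := swapEJ a x u v.
rewrite /symE LJ h.
have <- : swapE L x (J a *m z) y = - swapE L x z (J a *m y) by rewrite h.
ring.
Qed.

Lemma symE_skew : (forall x y z, L x y z = - L x z y) ->
  forall x y z, symE L x y z = - symE L x z y.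
Proof. by move=> h x y z; rewrite /symE (h x y z); ring. Qed.

End Swap.

Section TraceTensor.
Variables (f : V -> K) (hf : lform f) (c : K).

(* On decomposable arguments: gE e1 e2 * f (e3 (x) h1) * eps h2 h3. *)
Definition traceE x y z : K :=
  2^-1 * (- b x y * f z + b (J 0 *m x) y * f (J 0 *m z)
          + b (J 1 *m x) y * f (J 1 *m z) + b (J 2 *m x) y * f (J 2 *m z)).

(** The pure trace with covector [f]. The first two terms together are symmetric in the E-parts of
    [y] and [z], the minus sign again coming from eps; the last one, for [c] equal to 1/n, removes
    the trace over these parts. *)
Definition trace_tensor x y z : K :=
  traceE x y z - traceE x z y - c * f x * b y z.

Lemma traceE_tform : tform traceE.
Proof.
split=> u v a x y; rewrite /traceE !(mulmx_lcomb, hf, bform_l, bform_r); ring.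
Qed.

Lemma trace_tensor_tform : tform trace_tensor.
Proof.
have [s1 s2 s3] := traceE_tform.
split=> u v a x y; rewrite /trace_tensor !(s1, s2, s3, hf, bform_l, bform_r); ring.
Qed.

Lemma traceEJ a x y z : traceE x (J a *m y) z = - traceE x y (J a *m z).
Proof.
move: a; apply: forall_I3;
  by rewrite /traceE !bJl !quatE !bformE !(lformE hf); ring.
Qed.

Lemma trace_tensorJ a x y z :
  trace_tensor x (J a *m y) z = - trace_tensor x y (J a *m z).
Proof.
rewrite /trace_tensor traceEJ bJl.
have <- : traceE x (J a *m z) y = - traceE x z (J a *m y) by rewrite traceEJ.
ring.
Qed.

Lemma trace_tensor_skew x y z : trace_tensor x y z = - trace_tensor x z y.
Proof. by case: hW => h _; rewrite /trace_tensor (h z y); ring. Qed.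

(** By [bJsym] each [J a] term is symmetric in the two vectors paired by [b], so these terms cancel
    in the cyclic sum; the untwisted terms are skew there and add up. *)
Lemma trace_tensor_cyclic x y z :
  trace_tensor x y z + trace_tensor y z x + trace_tensor z x y =
  - (1 + c) * (b x y * f z + b y z * f x + b z x * f y).
Proof.
have h := hW.1; have s := bJsym.
rewrite /trace_tensor /traceE !bJl (h y x) (h z y) (h x z).
rewrite !(s _ y x) !(s _ z y) !(s _ x z).
have two : (2 : K) != 0 by rewrite pnatr_eq0.
by field.
Qed.

End TraceTensor.
End Quaternionic.

(** * Complex extension of real tensors *)

Section Complexification.
Local Open Scope complex_scope.
Local Notation formC := Defs.formC.
Variables (R : realType) (n : nat).
Local Notation C := R[i].
Local Notation iC := (@imC R).
Local Notation V := 'cV[R]_(4 * n).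
Local Notation VC := 'cV[C]_(4 * n).
Implicit Types (t : V -> V -> V) (z : VC).

Lemma imC_sqr : iC * iC = -1.
Proof. by apply/eqP; rewrite eq_complex /= !mul0r !mul1r sub0r addr0 oppr0 !eqxx. Qed.

Lemma imC_neq0 : iC != 0.
Proof. by rewrite eq_complex /= oner_eq0 andbF. Qed.

Lemma complexE_imC (a : C) :
  a = (complex.Re a)%:C + iC * (complex.Im a)%:C.
Proof.
by case: a => x y; apply/eqP; rewrite eq_complex /=; apply/andP; split; apply/eqP; ring.
Qed.

Lemma real_complexE : (forall x y : R, (x + y)%:C = x%:C + y%:C) *
  (forall x y : R, (x * y)%:C = x%:C * y%:C) * (forall x : R, (- x)%:C = - x%:C) *
  (forall x : R, (x^-1)%:C = (x%:C)^-1) * (forall k, (k%:R : R)%:C = k%:R).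
Proof.
by do !split=> *; rewrite ?rmorphD ?rmorphM ?rmorphN ?fmorphV ?rmorph_nat.
Qed.

Lemma cplx_split z : z = cplx (re_part z) + iC *: cplx (im_part z).
Proof. by apply/colP => i; rewrite !mxE; exact: complexE_imC. Qed.

Lemma cplx_coord p q (A B : 'M[R]_(p, q)) i j :
  (cplx A + iC *: cplx B) i j = Complex (A i j) (B i j).
Proof.
rewrite !mxE; apply/eqP; rewrite eq_complex /=.
by apply/andP; split; apply/eqP; ring.
Qed.

Lemma re_part_cplx (u : V) : re_part (cplx u) = u.
Proof. by apply/colP => i; rewrite !mxE. Qed.

Lemma im_part_cplx (u : V) : im_part (cplx u) = 0.
Proof. by apply/colP => i; rewrite !mxE. Qed.

Lemma re_partP a z z' : re_part (a *: z + z') =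
  complex.Re a *: re_part z + ((- complex.Im a) *: im_part z + re_part z').
Proof.
apply/colP => i; rewrite !mxE; case: a => x y.
by case: (z i 0) => ? ?; case: (z' i 0) => ? ? /=; ring.
Qed.

Lemma im_partP a z z' : im_part (a *: z + z') =
  complex.Re a *: im_part z + (complex.Im a *: re_part z + im_part z').
Proof.
apply/colP => i; rewrite !mxE; case: a => x y.
by case: (z i 0) => ? ?; case: (z' i 0) => ? ? /=; ring.
Qed.

Lemma ext2_coord t z z' i : ext2 t z z' i 0 =
  Complex ((t (re_part z) (re_part z') - t (im_part z) (im_part z')) i 0)
          ((t (re_part z) (im_part z') + t (im_part z) (re_part z')) i 0).
Proof.
exact: cplx_coord.
Qed.

Lemma ext2_linl t a z1 z2 z : bilinear2 t ->
  ext2 t (a *: z1 + z2) z = a *: ext2 t z1 z + ext2 t z2 z.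
Proof.
move=> [tl tr]; apply/colP => i.
rewrite [RHS]mxE [X in _ = X + _]mxE !ext2_coord re_partP im_partP !tl !mxE.
by case: a => x y; apply/eqP; rewrite eq_complex /=; apply/andP; split; apply/eqP; ring.
Qed.

Lemma ext2_linr t a z1 z2 z : bilinear2 t ->
  ext2 t z (a *: z1 + z2) = a *: ext2 t z z1 + ext2 t z z2.
Proof.
move=> [tl tr]; apply/colP => i.
rewrite [RHS]mxE [X in _ = X + _]mxE !ext2_coord re_partP im_partP !tr !mxE.
by case: a => x y; apply/eqP; rewrite eq_complex /=; apply/andP; split; apply/eqP; ring.
Qed.

Lemma bilinear2_0l t v : bilinear2 t -> t 0 v = 0.
Proof.
move=> [tl _]; have := tl 1 0 0 v; rewrite scaler0 addr0 scale1r.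
by move/(congr1 (fun y => y - t 0 v)); rewrite subrr addrK.
Qed.

Lemma bilinear2_0r t v : bilinear2 t -> t v 0 = 0.
Proof.
move=> [_ tr]; have := tr 1 v 0 0; rewrite scaler0 addr0 scale1r.
by move/(congr1 (fun y => y - t v 0)); rewrite subrr addrK.
Qed.

Lemma ext2_cplx t (u v : V) : bilinear2 t -> ext2 t (cplx u) (cplx v) = cplx (t u v).
Proof.
move=> ht; apply/colP => i; rewrite ext2_coord !re_part_cplx !im_part_cplx.
by rewrite !(bilinear2_0r _ ht) (bilinear2_0l _ ht) subr0 addr0 !mxE.
Qed.

Lemma ext2_add t1 t2 t z z' : (forall u v, t u v = t1 u v + t2 u v) ->
  ext2 t z z' = ext2 t1 z z' + ext2 t2 z z'.
Proof.
move=> ht; apply/colP => i; rewrite [RHS]mxE !ext2_coord !ht !mxE.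
by apply/eqP; rewrite eq_complex /=; apply/andP; split; apply/eqP; ring.
Qed.

Lemma lform_ext (f g : VC -> C) : lform f -> lform g ->
  (forall u : V, f (cplx u) = g (cplx u)) -> f =1 g.
Proof.
move=> hf hg h z; rewrite [z]cplx_split !(lformD hf, lformD hg, lformZ hf, lformZ hg).
by rewrite !h.
Qed.

(** Carries identities between real tensors over to V (x) C, and so to vectors of E, which are not
    real. *)
Lemma tform_ext (F G : VC -> VC -> VC -> C) : tform F -> tform G ->
  (forall u v v' : V, F (cplx u) (cplx v) (cplx v') = G (cplx u) (cplx v) (cplx v')) ->
  forall z1 z2 z3, F z1 z2 z3 = G z1 z2 z3.
Proof.
move=> [F1 F2 F3] [G1 G2 G3] h z1 z2 z3.
apply: (lform_ext (F1 z2 z3) (G1 z2 z3)) => u /=.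
apply: (lform_ext (F2 _ z3) (G2 _ z3)) => v /=.
exact: (lform_ext (F3 _ _) (G3 _ _)).
Qed.

Lemma cplxM p q r (A : 'M[R]_(p, q)) (B : 'M[R]_(q, r)) :
  cplx (A *m B) = cplx A *m cplx B.
Proof. exact: map_mxM. Qed.

Lemma rform_cplx (xi : 'rV[R]_(4 * n)) (u : V) :
  rform (cplx xi) (cplx u) = (rform xi u)%:C.
Proof. by rewrite !rformE -cplxM mxE. Qed.

Section CoordinateForms.
Variables (J : 'I_3 -> 'M[R]_(4 * n)) (w : 'M[R]_(4 * n)).

Definition gform : VC -> VC -> C := locked_with lock_key (gE J w).

Lemma gform_gE e e' : gform e e' = gE J w e e'.
Proof. by rewrite /gform unlock. Qed.

Lemma gformE e e' : gform e e' = bform (cplx w) e (cplx (J 1) *m e').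
Proof. by rewrite gform_gE bform_mx. Qed.

Lemma formvE u v : formv w u v = bform w u v.
Proof. by rewrite bform_mx. Qed.

Lemma formCE z z' : formC w z z' = bform (cplx w) z z'.
Proof. by rewrite bform_mx. Qed.

Lemma dual_bases_gform (bb bb' : 'I_(2 * n) -> VC) k l :
  dual_bases J w bb bb' -> gform (bb k) (bb' l) = (k == l)%:R.
Proof. by case=> _ _ h; rewrite gform_gE h. Qed.

Definition ehform : (VC -> C) -> C * C -> VC -> C :=
  locked_with lock_key (fun f h e => f (eh J e h)).

Lemma ehformE f h e : ehform f h e = f (eh J e h).
Proof. by rewrite /ehform unlock. Qed.

Lemma ehform_lform f h : lform f -> lform (ehform f h).
Proof.
move=> hf a x y; rewrite !ehformE /eh mulmx_lcomb !(lformD hf) !(lformZ hf).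
by rewrite !hf; ring.
Qed.

End CoordinateForms.

Section Form.
Variable w : 'M[R]_(4 * n).

Lemma bform_cplx (u v : V) : bform (cplx w) (cplx u) (cplx v) = (bform w u v)%:C.
Proof. by rewrite !bform_mx [(cplx u)^T]matrix.map_trmx -!cplxM mxE. Qed.

Definition low : (V -> V -> V) -> VC -> VC -> VC -> C :=
  locked_with lock_key (fun t z1 z2 z3 => bform (cplx w) (ext2 t z1 z2) z3).

Lemma lowE t z1 z2 z3 : low t z1 z2 z3 = bform (cplx w) (ext2 t z1 z2) z3.
Proof. by rewrite /low unlock. Qed.

Lemma low_tform t : bilinear2 t -> tform (low t).
Proof.
move=> ht; split=> z z' a x y; rewrite !lowE.
- by rewrite ext2_linl // bform_l.
- by rewrite ext2_linr // bform_l.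
- exact: bform_r.
Qed.

Lemma low_cplx t u v v' : bilinear2 t ->
  low t (cplx u) (cplx v) (cplx v') = (bform w (t u v) v')%:C.
Proof. by move=> ht; rewrite lowE ext2_cplx //; exact: bform_cplx. Qed.

End Form.

End Complexification.

(** * Forms evaluated on decomposable vectors of E (x) H *)

Section EHCoordinates.
Local Open Scope complex_scope.
Variables (R : realType) (n : nat).
Local Notation C := R[i].
Local Notation iC := (@imC R).
Local Notation V := 'cV[R]_(4 * n).
Local Notation VC := 'cV[C]_(4 * n).
Implicit Types (t : V -> V -> V) (z : VC).

Section Structure.
Variables (J : 'I_3 -> 'M[R]_(4 * n)) (w : 'M[R]_(4 * n)).
Hypotheses (hJ : quaternionic J) (hw : skew_hermitian J w).
Let JC (a : 'I_3) : 'M[C]_(4 * n) := cplx (J a).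
Local Notation g := (gform J w).
Local Notation b := (bform (cplx w)).

Lemma cplx_quaternionic : quaternionic JC.
Proof.
case: hJ => h1 h2 h3; split=> [a||]; rewrite /JC -cplxM ?h1 ?h2 ?h3 //.
  by rewrite /cplx raddfN /= map_scalar_mx rmorph1.
by rewrite /cplx raddfN.
Qed.

Lemma cplx_skew_hermitian : skew_hermitian JC (cplx w).
Proof.
case: hw => h1 h2; split=> [x y|a x y].
  apply: (@lform_ext R n (b^~ y) (fun x => - b y x)) => [|a z z'|u] /=.
  - exact: bform_l.
  - by rewrite bform_r; ring.
  apply: (@lform_ext R n (b (cplx u)) (fun y => - b y (cplx u))) => [|a z z'|v] /=.
  - exact: bform_r.
  - by rewrite bform_l; ring.
  by rewrite !bform_cplx [bform w _ _]h1 rmorphN.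
apply: (@lform_ext R n (fun x => b (JC a *m x) (JC a *m y))
  (fun x => b x y)) => [c z z'|c z z'|u] /=.
- by rewrite mulmx_lcomb bform_l.
- by rewrite bform_l.
apply: (@lform_ext R n (fun y => b (JC a *m cplx u) (JC a *m y))
  (b (cplx u))) => [c z z'|c z z'|v] /=.
- by rewrite mulmx_lcomb bform_r.
- by rewrite bform_r.
by rewrite /JC -!cplxM !bform_cplx [bform w _ _]h2.
Qed.

Let hJC := cplx_quaternionic.
Let hwC := cplx_skew_hermitian.
Let qE := quatE hJC.

Section EVector.
Variable e : VC.
Hypothesis he : inE1 J e.

Lemma J0E : JC 0 *m e = iC *: e. Proof. exact: he. Qed.

Lemma J2E : JC 2 *m e = - iC *: (JC 1 *m e).
Proof.
have h : JC 1 *m (JC 0 *m e) = - (JC 2 *m e) by rewrite qE.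
by rewrite -[LHS]opprK -h J0E -scalemxAr scaleNr.
Qed.

Lemma J01E : JC 0 *m (JC 1 *m e) = - iC *: (JC 1 *m e).
Proof. by rewrite qE J2E. Qed.

Lemma J21E : JC 2 *m (JC 1 *m e) = - iC *: e.
Proof. by rewrite qE J0E scaleNr. Qed.

Lemma JE : (JC 0 *m e = iC *: e) * (JC 2 *m e = - iC *: (JC 1 *m e)) *
  (JC 0 *m (JC 1 *m e) = - iC *: (JC 1 *m e)) *
  (JC 2 *m (JC 1 *m e) = - iC *: e) * (JC 1 *m (JC 1 *m e) = - e).
Proof. by rewrite J0E J2E J01E J21E qE. Qed.

End EVector.

Lemma eh10 e : eh J e (1, 0) = e.
Proof. by rewrite /eh /= scale1r scale0r addr0. Qed.

Lemma eh01 e : eh J e (0, 1) = JC 1 *m e.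
Proof. by rewrite /eh /= scale1r scale0r add0r. Qed.

Lemma eh_span z : exists e e', [/\ inE1 J e, inE1 J e' &
  z = eh J e (1, 0) + eh J e' (0, 1)].
Proof.
(* [e] is the projection of [z] to the i-eigenspace of [J 0]. The remainder lies in the
   (-i)-eigenspace, which is [J 1] applied to E; [e'] is its preimage, the inverse of [J 1] being -
   [J 1]. *)
pose e := 2^-1 *: (z - iC *: (JC 0 *m z)).
pose e' := - 2^-1 *: (JC 1 *m (z + iC *: (JC 0 *m z))).
have two : (2 : C) != 0 by rewrite pnatr_eq0.
have i2 := imC_sqr R.
exists e, e'; split.
- rewrite /inE1 -/(JC 0) /e -scalemxAr mulmxBr -scalemxAr qE scalerN opprK.
  rewrite scalerA mulrC -scalerA; congr (_ *: _).
  by rewrite scalerBr scalerA i2 scaleN1r opprK addrC.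
- rewrite /inE1 -/(JC 0) /e' -scalemxAr qE scalerA mulrC -scalerA; congr (_ *: _).
  rewrite !mulmxDr -!scalemxAr !qE scalerDr !scalerN scalerA i2.
  by rewrite scaleN1r opprK addrC.
rewrite eh10 eh01 /e /e' -scalemxAr qE scaleNr scalerN opprK.
rewrite -scalerDr addrACA addNr addr0.
have -> : z + z = (2 : C) *: z by rewrite scaler_nat mulr2n.
by rewrite scalerA mulVf // scale1r.
Qed.

(** E is isotropic: [J 0] is the scalar i on both vectors, and moving it across [b] costs a sign. *)
Lemma bEE e e' : inE1 J e -> inE1 J e' -> b e e' = 0.
Proof.
move=> he he'; have /eqP := bJl hJC hwC 0 e e'.
rewrite (J0E he) (J0E he') !bformE -addr_eq0 -mulr2n mulrn_eq0 /= mulf_eq0.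
by rewrite (negPf (imC_neq0 R)) => /eqP.
Qed.

Lemma bE1E e e' : b (JC 1 *m e) e' = - g e e'.
Proof. by rewrite (bJl hJC hwC) gformE. Qed.

Lemma bE1E1 e e' : inE1 J e -> inE1 J e' -> b (JC 1 *m e) (JC 1 *m e') = 0.
Proof. by move=> he he'; rewrite hwC.2 bEE. Qed.

Lemma bEE1 e e' : b e (JC 1 *m e') = g e e'. Proof. by rewrite gformE. Qed.

Lemma gE_sym e e' : g e e' = g e' e.
Proof. by rewrite !gformE; exact: (bJsym hJC hwC). Qed.

Lemma gE_lin e' : lform (g^~ e').
Proof. by move=> a x y; rewrite !gformE bform_l. Qed.

Section Commuting.
Variable L : VC -> VC -> VC -> C.
Hypotheses (hL : tform L)
  (LJ : forall a x y z, L x (JC a *m y) z = - L x y (JC a *m z)).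
Let LE := tformE hL.

Lemma formEE z e e' : inE1 J e -> inE1 J e' -> L z e e' = 0.
Proof.
move=> he he'; have /eqP := LJ 0 z e e'.
rewrite (J0E he) (J0E he') !LE -addr_eq0 -mulr2n mulrn_eq0 /= mulf_eq0.
by rewrite (negPf (imC_neq0 R)) => /eqP.
Qed.

Lemma formE1E z e e' : L z (JC 1 *m e) e' = - L z e (JC 1 *m e').
Proof. exact: LJ. Qed.

Lemma formE1E1 z e e' : inE1 J e -> inE1 J e' -> L z (JC 1 *m e) (JC 1 *m e') = 0.
Proof. by move=> he he'; rewrite LJ qE LE formEE // !oppr0. Qed.

(** By [LJ], the form in the last two arguments is invariant under sp(1), so its H-factor can only
    be a multiple of eps. *)
Lemma form_eh z e2 h2 e3 h3 : inE1 J e2 -> inE1 J e3 ->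
  L z (eh J e2 h2) (eh J e3 h3) =
  (h2.1 * h3.2 - h2.2 * h3.1) * L z e2 (JC 1 *m e3).
Proof.
move=> he2 he3; rewrite /eh -/(JC 1) !LE formEE // formE1E1 // formE1E; ring.
Qed.

Lemma swapE_eh e1 h e2 e3 : inE1 J e1 -> inE1 J e2 -> inE1 J e3 ->
  swapE JC L (eh J e1 h) e2 (JC 1 *m e3) = L (eh J e2 h) e1 (JC 1 *m e3).
Proof.
move=> he1 he2 he3; have i2 := imC_sqr R.
have two : (2 : C) != 0 by rewrite pnatr_eq0.
rewrite /swapE /eh -/(JC 1) !(JE he2) !(JE he3) !LE.
rewrite !(formE1E1 _ he1 he3) !formE1E !(formEE _ he1 he3).
by field: i2.
Qed.

End Commuting.

Lemma J_eh e h : inE1 J e ->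
  (JC 0 *m eh J e h = eh J e (iC * h.1, - iC * h.2)) *
  (JC 1 *m eh J e h = eh J e (- h.2, h.1)) *
  (JC 2 *m eh J e h = eh J e (- iC * h.2, - iC * h.1)).
Proof.
move=> he; rewrite /eh -/(JC 1) !mulmx_colE !(JE he) /=.
rewrite !scalerA !scalerN !scaleNr ?mulrN ?mulNr !scaleNr !(mulrC h.1, mulrC h.2).
do !split; rewrite // addrC //.
Qed.

Lemma bform_eh e1 h1 e2 h2 : inE1 J e1 -> inE1 J e2 ->
  b (eh J e1 h1) (eh J e2 h2) = (h1.1 * h2.2 - h1.2 * h2.1) * g e1 e2.
Proof.
move=> he1 he2; rewrite /eh -/(JC 1).
rewrite (bform_l _ _ h1.1) (lformZ (bform_l _ _)).
rewrite !(bform_r _ _ h2.1) !(lformZ (bform_r _ _)).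
rewrite bEE // bE1E1 // bE1E bEE1; ring.
Qed.

Lemma traceE_eh (f : VC -> C) (hf : lform f) e1 h e2 e3 :
  inE1 J e1 -> inE1 J e2 -> inE1 J e3 ->
  traceE JC (cplx w) f (eh J e1 h) e2 (JC 1 *m e3) = g e1 e2 * f (eh J e3 h).
Proof.
move=> he1 he2 he3; have i2 := imC_sqr R.
have two : (2 : C) != 0 by rewrite pnatr_eq0.
rewrite /traceE !(J_eh h he1) -(eh10 e2) !bform_eh // eh10 !(JE he3) /=.
rewrite /eh !(lformE hf).
by field: i2.
Qed.

Section DualBases.
Variables (bb bb' : 'I_(2 * n) -> VC).
Hypothesis hb : dual_bases J w bb bb'.

Lemma dual_bases_sym : dual_bases J w bb' bb.
Proof.
case: (hb) => h1 h2 _; split=> // k l.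
by rewrite -gform_gE gE_sym (dual_bases_gform _ _ hb) eq_sym.
Qed.

(** Needed because [2 * n + 2 * n] and [4 * n] are equal but not convertible. *)
Lemma mulmx1C_cast (p q : nat) (A : 'M[C]_(p, q)) (B : 'M[C]_(q, p)) : p = q ->
  A *m B = 1%:M -> B *m A = 1%:M.
Proof. by move=> e; case: q / e A B => A B; exact: mulmx1C. Qed.

(** The vectors [bb k], [J 1 bb k] and the vectors [J 1 bb' k], - [bb' k] are dual for [b], since E
    and [J 1] E are isotropic. As there are 4n of each, the one-sided inverse [FF'] is two-sided,
    and this gives the expansion. *)
Lemma dual_bases_expand z : z =
  \sum_(k < 2 * n) (b z (JC 1 *m bb' k) *: bb k - b z (bb' k) *: (JC 1 *m bb k)).
Proof.
case: (hb) => h1 h2 _.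
have h3 k l : g (bb k) (bb' l) = (k == l)%:R := dual_bases_gform k l hb.
pose f (j : 'I_(2 * n + 2 * n)) :=
  match fintype.split j with inl k => bb k | inr k => JC 1 *m bb k end.
pose f' (j : 'I_(2 * n + 2 * n)) :=
  match fintype.split j with inl k => JC 1 *m bb' k | inr k => - bb' k end.
pose F : 'M[C]_(_, _) := \matrix_(i, j) f j i 0.
pose F' : 'M[C]_(_, _) := \matrix_(i, j) f' j i 0.
have dim : (2 * n + 2 * n = 4 * n)%N by rewrite -mulnDl.
have FF' : F^T *m (cplx w *m F') = 1%:M.
  apply/matrixP => j l; rewrite mulmxA bform_col mxE.
  have cE (h : 'I_(2 * n + 2 * n) -> VC) k : col k (\matrix_(i, j) h j i 0) = h k.
    by apply/colP => i; rewrite !mxE.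
  rewrite !cE /f /f'.
  case: (split_ordP j) => j' ->; case: (split_ordP l) => l' ->.
  - by rewrite eq_lshift bEE1 h3.
  - by rewrite eq_lrshift bformE bEE // oppr0.
  - by rewrite eq_rlshift bE1E1.
  - by rewrite eq_rshift bformE bE1E opprK h3.
have FQ := mulmx1C_cast dim FF'.
apply: trmx_inj; rewrite -[LHS]mulmx1 -FQ; apply/rowP => i.
have cE j : (z^T *m (cplx w *m F')) 0 j = b z (f' j).
  rewrite bform_mx mulmxA [LHS]mxE [RHS]mxE; apply: eq_bigr => l _.
  by rewrite [F' _ _]mxE.
rewrite mulmxA [LHS]mxE [RHS]mxE big_split_ord summxE /= -big_split /=.
apply: eq_bigr => k _; rewrite !cE ![F^T _ _]mxE ![F _ _]mxE /f /f'.
have -> : fintype.split (lshift (2 * n) k) = inl k by exact: (unsplitK (inl k)).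
have -> : fintype.split (rshift (2 * n) k) = inr k by exact: (unsplitK (inr k)).
rewrite bformE mulNr [RHS]mxE.
by rewrite [X in _ = X + _]mxE [X in _ = _ + X]mxE [X in _ = _ - X]mxE.
Qed.

End DualBases.
End Structure.
End EHCoordinates.

(** * Symmetry over E and the comparison of E-traces with contractions over V *)

Section Tensors.
Local Open Scope complex_scope.
Variables (R : realType) (n : nat).
Local Notation C := R[i].
Local Notation V := 'cV[R]_(4 * n).
Local Notation VC := 'cV[C]_(4 * n).
Variables (J : 'I_3 -> 'M[R]_(4 * n)) (w : 'M[R]_(4 * n)).
Hypotheses (hJ : quaternionic J) (hw : skew_hermitian J w).
Let JC (a : 'I_3) : 'M[C]_(4 * n) := cplx (J a).
Local Notation g := (gform J w).
Local Notation b := (bform (cplx w)).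
Local Notation L := (low w).
Implicit Types (t A : V -> V -> V).

Definition quaternion_linear t := forall a u v, t u (J a *m v) = J a *m t u v.
Definition form_skew t := forall u v v', bform w (t u v) v' = - bform w (t u v') v.

Lemma lowJ t : bilinear2 t -> quaternion_linear t -> forall a z1 z2 z3,
  L t z1 (JC a *m z2) z3 = - L t z1 z2 (JC a *m z3).
Proof.
move=> ht tJ a; have [l1 l2 l3] := low_tform w ht.
apply: (@tform_ext R n (fun z1 z2 z3 => L t z1 (JC a *m z2) z3)
  (fun z1 z2 z3 => - L t z1 z2 (JC a *m z3))).
- by split=> y z c x x'; [rewrite l1 | rewrite mulmx_lcomb l2 | rewrite l3].
- by split=> y z c x x'; [rewrite l1 | rewrite l2 | rewrite mulmx_lcomb l3]; ring.
by move=> u v v'; rewrite /JC -!cplxM !low_cplx // tJ (bJl hJ hw) rmorphN.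
Qed.

Lemma low_skew t : bilinear2 t -> form_skew t -> forall z1 z2 z3,
  L t z1 z2 z3 = - L t z1 z3 z2.
Proof.
move=> ht ts; have [l1 l2 l3] := low_tform w ht.
apply: (@tform_ext R n (L t) (fun z1 z2 z3 => - L t z1 z3 z2)) => //.
- by split=> y z c x x'; [rewrite l1 | rewrite l3 | rewrite l2]; ring.
by move=> u v v'; rewrite !low_cplx // ts rmorphN.
Qed.

Definition sform : (V -> V -> V) -> VC -> C * C -> VC -> VC -> C :=
  locked_with lock_key (symb J w).

Lemma sform_symb t e1 h e2 e3 : sform t e1 h e2 e3 = symb J w t e1 h e2 e3.
Proof. by rewrite /sform unlock. Qed.

Lemma sformE t e1 h e2 e3 : sform t e1 h e2 e3 = L t (eh J e1 h) e2 (JC 1 *m e3).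
Proof. by rewrite sform_symb /symb /lower eh10 eh01 formCE lowE. Qed.

(** Skewness for [w] becomes symmetry over E once the skew factor eps is split off. *)
Lemma sform_sym t e1 h e2 e3 : bilinear2 t -> quaternion_linear t -> form_skew t ->
  sform t e1 h e2 e3 = sform t e1 h e3 e2.
Proof.
by move=> ht tJ ts; rewrite !sformE (low_skew ht ts) (lowJ ht tJ) opprK.
Qed.

Lemma lower_sform t e1 h1 e2 h2 e3 h3 : bilinear2 t -> quaternion_linear t ->
  inE1 J e2 -> inE1 J e3 ->
  lower J w t e1 h1 e2 h2 e3 h3 =
  (h2.1 * h3.2 - h2.2 * h3.1) * sform t e1 h1 e2 e3.
Proof.
move=> ht tJ he2 he3; have -> : lower J w t e1 h1 e2 h2 e3 h3 =
  L t (eh J e1 h1) (eh J e2 h2) (eh J e3 h3) by rewrite lowE /lower formCE.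
by rewrite sformE (form_eh hJ (low_tform w ht) (lowJ ht tJ)).
Qed.

Lemma ext2_trace1_lform t : bilinear2 t ->
  lform (fun z => \sum_(j < 4 * n) ext2 t (delta_mx j 0) z j 0).
Proof.
move=> ht a x y; rewrite mulr_sumr -big_split; apply: eq_bigr => j _ /=.
by rewrite ext2_linr // mxE [X in X + _]mxE.
Qed.

Lemma ext2_trace2_lform t : bilinear2 t ->
  lform (fun z => \sum_(j < 4 * n) ext2 t z (delta_mx j 0) j 0).
Proof.
move=> ht a x y; rewrite mulr_sumr -big_split; apply: eq_bigr => j _ /=.
by rewrite ext2_linl // mxE [X in X + _]mxE.
Qed.

Lemma cplx_delta (j : 'I_(4 * n)) : delta_mx j 0 = cplx (delta_mx j 0) :> VC.
Proof. by rewrite /cplx map_delta_mx. Qed.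

Lemma ext2_trace1_cplx t v : bilinear2 t ->
  \sum_(j < 4 * n) ext2 t (delta_mx j 0) (cplx v) j 0 =
  (\sum_(j < 4 * n) t (delta_mx j 0) v j 0)%:C.
Proof.
move=> ht; rewrite rmorph_sum; apply: eq_bigr => j _ /=.
by rewrite cplx_delta ext2_cplx // mxE.
Qed.

Lemma ext2_trace2_cplx t v : bilinear2 t ->
  \sum_(j < 4 * n) ext2 t (cplx v) (delta_mx j 0) j 0 =
  (\sum_(j < 4 * n) t v (delta_mx j 0) j 0)%:C.
Proof.
move=> ht; rewrite rmorph_sum; apply: eq_bigr => j _ /=.
by rewrite cplx_delta ext2_cplx // mxE.
Qed.

Section DualBases.
Variables (bb bb' : 'I_(2 * n) -> VC).
Hypothesis hb : dual_bases J w bb bb'.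

Lemma gE_expand e : inE1 J e -> forall f : VC -> C, lform f ->
  \sum_(k < 2 * n) g e (bb' k) * f (bb k) = f e.
Proof.
move=> he f hf; rewrite [in RHS](dual_bases_expand hJ hw hb e) (lform_sum hf).
case: hb => h1 h2 _; apply: eq_bigr => k _.
by rewrite (lformD hf) (lformN hf) !(lformZ hf) (bEE hJ hw he (h2 k)) mul0r subr0 bEE1.
Qed.

(** The trace of [P] in the basis [bb k], [J 1 bb k], with the coordinates given by
    [dual_bases_expand]. *)
Lemma trace_dual (P : VC -> VC) :
  (forall a x y, P (a *: x + y) = a *: P x + P y) ->
  \sum_(j < 4 * n) P (delta_mx j 0) j 0 =
  \sum_(k < 2 * n) (b (P (bb k)) (JC 1 *m bb' k) - b (P (JC 1 *m bb k)) (bb' k)).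
Proof.
move=> hP.
have hPj j : lform (fun x => P x j 0) by move=> a x y; rewrite hP mxE [X in X + _]mxE.
have hd z y : \sum_(j < 4 * n) b (delta_mx j 0) y * P z j 0 = b (P z) y.
  rewrite [RHS](lform_coord (bform_l _ y)).
  by apply: eq_bigr => j _; rewrite mulrC.
under eq_bigr => j _.
  rewrite [X in P X](dual_bases_expand hJ hw hb (delta_mx j 0)) (lform_sum (hPj j)).
  over.
rewrite exchange_big /=; apply: eq_bigr => k _.
rewrite -!hd -sumrB; apply: eq_bigr => j _.
by rewrite (lformD (hPj j)) (lformN (hPj j)) !(lformZ (hPj j)).
Qed.

(** The endomorphism [t z] acts on E (x) H through E alone; the factor 2 is the dimension of H. *)
Lemma trace2_low t z : bilinear2 t -> quaternion_linear t ->
  \sum_(j < 4 * n) ext2 t z (delta_mx j 0) j 0 =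
  2 * \sum_(k < 2 * n) L t z (bb k) (JC 1 *m bb' k).
Proof.
move=> ht tJ; rewrite (@trace_dual (ext2 t z)); last first.
  by move=> a x y; rewrite ext2_linr.
rewrite mulr_sumr; apply: eq_bigr => k _.
by rewrite -!lowE (lowJ ht tJ) opprK mulr2n mulrDl !mul1r.
Qed.

(** Here the first argument is contracted with the value. The contraction over H then runs through
    eps and moves [h] to the first slot, so no factor 2 appears. *)
Lemma trace1_low t e h : bilinear2 t -> quaternion_linear t -> inE1 J e ->
  \sum_(j < 4 * n) ext2 t (delta_mx j 0) (eh J e h) j 0 =
  \sum_(k < 2 * n) L t (eh J (bb k) h) e (JC 1 *m bb' k).
Proof.
move=> ht tJ he; rewrite (@trace_dual (fun x => ext2 t x (eh J e h))); last first.
  by move=> a x y; rewrite ext2_linl.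
have [l1 l2 l3] := low_tform w ht; case: hb => _ h2 _.
apply: eq_bigr => k _; rewrite -!lowE.
have F z h3 := form_eh hJ (low_tform w ht) (lowJ ht tJ) z h h3 he (h2 k).
have := F (bb k) (0, 1); have := F (JC 1 *m bb k) (1, 0).
rewrite eh10 eh01 => -> ->.
rewrite /eh -/(JC 1) (l1 _ _ h.1) (lformZ (l1 _ _)) /=; ring.
Qed.

(** The right-hand side involves no dual bases, so the E-trace is the same for all of them. *)
Lemma sform_trace t e h : bilinear2 t -> quaternion_linear t -> form_skew t ->
  inE1 J e ->
  \sum_(k < 2 * n) sform t (bb k) h (bb' k) e =
  \sum_(j < 4 * n) ext2 t (delta_mx j 0) (eh J e h) j 0.
Proof.
move=> ht tJ ts he; rewrite trace1_low //; apply: eq_bigr => k _.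
by rewrite sform_sym // sformE.
Qed.

End DualBases.
End Tensors.

(** * Existence of dual bases of E *)

Section DualBasesExistence.
Local Open Scope complex_scope.
Variables (R : realType) (n : nat).
Local Notation C := R[i].
Local Notation iC := (@imC R).
Variables (J : 'I_3 -> 'M[R]_(4 * n)) (w : 'M[R]_(4 * n)).
Hypotheses (hJ : quaternionic J) (hw : skew_hermitian J w) (w_unit : w \in unitmx).
Let JC (a : 'I_3) : 'M[C]_(4 * n) := cplx (J a).
Local Notation g := (gform J w).
Local Notation b := (bform (cplx w)).
Let hJC : quaternionic JC := cplx_quaternionic hJ.

(** [P] and [Q] are the spectral projections of [J 0], onto the eigenspaces of i (that is, E) and of
    -i. *)
Let P : 'M[C]_(4 * n) := 2^-1 *: (1%:M - iC *: JC 0).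
Let Q : 'M[C]_(4 * n) := 2^-1 *: (1%:M + iC *: JC 0).


Lemma scaler_half (U : lmodType C) (x : U) : 2^-1 *: (x + x) = x.
Proof. by rewrite scalerDr -scalerDl -[2^-1]mul1r -splitr scale1r. Qed.

Lemma cplx_unit : cplx w \in unitmx.
Proof. by rewrite map_unitmx. Qed.

Lemma JC0P : JC 0 *m P = iC *: P.
Proof.
rewrite /P -scalemxAr mulmxBr mulmx1 -scalemxAr; have [-> _ _] := hJC.
rewrite scalerA mulrC -scalerA; congr (_ *: _).
by rewrite scalerBr scalerA imC_sqr scaleN1r opprK scalerN opprK addrC.
Qed.

Lemma PQ1 : P + Q = 1%:M.
Proof.
by rewrite /P /Q -scalerDr addrACA addNr addr0 scaler_half.
Qed.

Lemma PQ0 : P *m Q = 0.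
Proof.
have h : (1%:M - iC *: JC 0) *m (1%:M + iC *: JC 0) = 0.
  rewrite mulmxDr mulmx1 mulmxBl mul1mx -scalemxAl -scalemxAr.
  have [-> _ _] := hJC.
  by rewrite scalerA imC_sqr scalerN scaleN1r opprK addrA subrK subrr.
by rewrite /P /Q -scalemxAl -scalemxAr h !scaler0.
Qed.

Lemma J1P : JC 1 *m P = Q *m JC 1.
Proof.
have [_ h01 h10] := hJC.
rewrite /P /Q -scalemxAr -scalemxAl mulmxBr mulmxDl mulmx1 mul1mx.
by rewrite -scalemxAr -scalemxAl h01 h10 scalerN opprK.
Qed.

(** Conjugation by [J 1], which anticommutes with [J 0], exchanges the two projections. *)
Lemma rankPQ : \rank P = \rank Q.
Proof.
have J1K : JC 1 *m JC 1 = - 1%:M by have [] := hJC.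
apply/eqP; rewrite eqn_leq; apply/andP; split.
  have -> : P = - (JC 1 *m Q *m JC 1).
    by rewrite -mulmxA -J1P mulmxA J1K mulNmx mul1mx opprK.
  rewrite eqmx_opp.
  exact: leq_trans (mxrankM_maxl _ _) (mxrankM_maxr _ _).
have -> : Q = - (JC 1 *m P *m JC 1).
  by rewrite J1P -mulmxA J1K mulmxN mulmx1 opprK.
rewrite eqmx_opp.
exact: leq_trans (mxrankM_maxl _ _) (mxrankM_maxr _ _).
Qed.

Lemma rankP : \rank P = (2 * n)%N.
Proof.
have h1 : (\rank P + \rank Q <= 4 * n)%N by apply: mulmx0_rank_max; exact: PQ0.
have h2 : (4 * n <= \rank P + \rank Q)%N.
  by rewrite -[X in (X <= _)%N](mxrank1 C) -PQ1 mxrank_add.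
have : (\rank P + \rank P)%N = (4 * n)%N.
  by apply/eqP; rewrite {2}rankPQ eqn_leq h1.
by move=> h; apply: double_inj; rewrite -addnn h -mul2n mulnA.
Qed.

Lemma inE1_P e : inE1 J e -> P *m e = e.
Proof.
move=> he; rewrite /P -scalemxAl mulmxBl mul1mx -scalemxAl.
by rewrite [JC 0 *m e]he scalerA imC_sqr scaleN1r opprK scaler_half.
Qed.

Lemma bform_gE_split e e1 e2 : inE1 J e -> inE1 J e1 ->
  b e (eh J e1 (1, 0) + eh J e2 (0, 1)) = g e e2.
Proof.
by move=> he he1; rewrite eh10 eh01 (lformD (bform_r _ _)) (bEE hJ hw) // add0r bEE1.
Qed.

(** A kernel vector of the Gram matrix [G] of gE on the columns of [B] yields a vector of E that is
    gE-orthogonal to E. As E is isotropic, it is then [w]-orthogonal to everything, hence zero. The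
    second basis is the first one multiplied by the inverse of [G]. The size [r] is abstract because
    [\rank P] is only provably [2 * n]. *)
Lemma dual_bases_of_factor r (B : 'M[C]_(4 * n, r)) (D : 'M[C]_(r, 4 * n)) :
  r = (2 * n)%N -> B *m D = P -> row_full B -> JC 0 *m B = iC *: B ->
  exists b b', dual_bases J w b b'.
Proof.
move=> er; subst r => BD Bfull JB.
have inB y : inE1 J (B *m y) by rewrite /inE1 mulmxA [_ *m B]JB scalemxAl.
pose G := B^T *m (cplx w *m JC 1) *m B.
have Gunit : G \in unitmx.
  rewrite -row_free_unit; apply/inj_row_free => u uG.
  pose e := B *m u^T.
  have eB y : b e (JC 1 *m (B *m y)) = 0.
    rewrite bform_mx /e trmx_mul trmxK -!mulmxA.
    have -> : u *m (B^T *m (cplx w *m (JC 1 *m (B *m y)))) = u *m G *m y.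
      by rewrite /G !mulmxA.
    by rewrite uG mul0mx mxE.
  have e0 : e = 0.
    apply: (bform_inj cplx_unit) => z.
    have [e1 [e2 [he1 he2 ->]]] := eh_span hJ z.
    rewrite bform_gE_split //; last exact: inB.
    rewrite -(inE1_P he2) -BD -mulmxA.
    rewrite gformE eB.
    by rewrite bform_mx trmx0 !mul0mx mxE.
  have : B *m u^T = B *m 0 by rewrite mulmx0.
  move/(row_full_inj Bfull)/(congr1 trmx); by rewrite trmxK trmx0.
exists (fun k => col k B), (fun k => col k (B *m invmx G)); split.
- by move=> k; rewrite colE; exact: inB.
- by move=> k; rewrite colE -mulmxA; exact: inB.
move=> k l; have : (G *m invmx G) k l = (k == l)%:R by rewrite mulmxV // mxE.
by rewrite -mulmxA bform_col bform_mx !mulmxA => <-; rewrite /gE /Defs.formC !mulmxA.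
Qed.

Lemma exists_dual_bases : exists b b', dual_bases J w b b'.
Proof.
apply: (@dual_bases_of_factor _ (col_base P) (row_base P)).
- exact: rankP.
- exact: mulmx_base.
- exact: col_base_full.
apply: (row_free_inj (row_base_free P)).
by rewrite -scalemxAl -mulmxA mulmx_base JC0P.
Qed.

End DualBasesExistence.

(** * Real tensors obtained by raising an index, and the pure traces [EH]^* *)

Section PureTraces.
Local Open Scope complex_scope.
Variables (R : realType) (n : nat).
Local Notation C := R[i].
Local Notation V := 'cV[R]_(4 * n).
Local Notation VC := 'cV[C]_(4 * n).
Variables (J : 'I_3 -> 'M[R]_(4 * n)) (w : 'M[R]_(4 * n)).
Hypotheses (n_gt0 : (0 < n)%N).
Hypotheses (hJ : quaternionic J) (hw : skew_hermitian J w) (w_unit : w \in unitmx).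
Let JC (a : 'I_3) : 'M[C]_(4 * n) := cplx (J a).
Local Notation g := (gform J w).
Local Notation L := (low w).
Local Notation sb := (sform J w).
Let hJC : quaternionic JC := cplx_quaternionic hJ.
Let hwC : skew_hermitian JC (cplx w) := cplx_skew_hermitian hw.
Implicit Types (t A : V -> V -> V) (T : V -> V -> V -> R).

Lemma nC0 : n%:R != 0 :> C. Proof. by rewrite pnatr_eq0 -lt0n. Qed.
Lemma nR0 : n%:R != 0 :> R. Proof. by rewrite pnatr_eq0 -lt0n. Qed.

Definition raise T u v : V := sharp w (T u v).

Section Raise.
Variable T : V -> V -> V -> R.
Hypothesis hT : tform T.

Lemma bform_raise u v z : bform w (raise T u v) z = T u v z.
Proof. by case: hT => _ _ h; rewrite /raise bform_sharp. Qed.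

Lemma raise_bilinear2 : bilinear2 (raise T).
Proof.
by case: hT => h1 h2 _; split=> a x y z; apply: (bform_inj w_unit) => z';
  rewrite bform_l !bform_raise ?h1 ?h2.
Qed.

Lemma raise_quaternion_linear :
  (forall a x y z, T x (J a *m y) z = - T x y (J a *m z)) ->
  quaternion_linear J (raise T).
Proof.
move=> TJ a x y; apply: (bform_inj w_unit) => z.
by rewrite (bJl hJ hw) !bform_raise.
Qed.

Lemma raise_form_skew : (forall x y z, T x y z = - T x z y) -> form_skew w (raise T).
Proof. by move=> h u v v'; rewrite !bform_raise. Qed.

Lemma low_raise (F : VC -> VC -> VC -> C) : tform F ->
  (forall u v z : V, F (cplx u) (cplx v) (cplx z) = (T u v z)%:C) ->
  forall z1 z2 z3, L (raise T) z1 z2 z3 = F z1 z2 z3.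
Proof.
move=> hF h; apply: tform_ext => //; first exact: low_tform raise_bilinear2.
by move=> u v z; rewrite low_cplx ?bform_raise //; exact: raise_bilinear2.
Qed.

End Raise.

(** [EH]^* (x) [S^2E]^*, with the trace part of S^2E included. *)
Definition admissible t := [/\ bilinear2 t, quaternion_linear J t & form_skew w t].

Lemma admissible_sub t1 t2 : admissible t1 -> admissible t2 ->
  admissible (fun u v => t1 u v - t2 u v).
Proof.
case=> [[l1 r1] J1 s1] [[l2 r2] J2 s2]; split; first split.
- by move=> a x y z; rewrite l1 l2 scalerBr opprD addrACA.
- by move=> a x y z; rewrite r1 r2 scalerBr opprD addrACA.
- by move=> a u v; rewrite J1 J2 mulmxBr.
- move=> u v z; rewrite !(lformD (bform_l _ _)) !(lformN (bform_l _ _)) s1 s2.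
  by rewrite opprD.
Qed.

Lemma EH_S20E_admissible t : EH_S20E J w t -> admissible t.
Proof. by case=> h1 h2 h3 _; split=> // u v v'; rewrite -!formvE. Qed.

Lemma admissible_EH_S20E t : admissible t ->
  (forall u : V, \sum_(k < 4 * n) t u (delta_mx k 0) k 0 = 0) -> EH_S20E J w t.
Proof. by case=> h1 h2 h3 h4; split=> // u v v'; rewrite !formvE. Qed.

Lemma EH_S20E_sub t1 t2 : EH_S20E J w t1 -> EH_S20E J w t2 ->
  EH_S20E J w (fun u v => t1 u v - t2 u v).
Proof.
move=> h1 h2.
have := admissible_sub (EH_S20E_admissible h1) (EH_S20E_admissible h2).
move/admissible_EH_S20E; apply=> u; case: h1 => _ _ _ h1; case: h2 => _ _ _ h2.
under eq_bigr do rewrite mxE [X in _ + X]mxE.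
by rewrite sumrB h1 h2 subr0.
Qed.

Lemma sform_add t t1 t2 e1 h e2 e3 : (forall u v, t u v = t1 u v + t2 u v) ->
  sb t e1 h e2 e3 = sb t1 e1 h e2 e3 + sb t2 e1 h e2 e3.
Proof. by move=> ht; rewrite !sformE !lowE (ext2_add _ _ ht) (lformD (bform_l _ _)). Qed.

Section Traces.
Variables (bb bb' : 'I_(2 * n) -> VC).
Hypothesis hb : dual_bases J w bb bb'.

Lemma sform_traceless t e h : EH_S20E J w t ->
  \sum_(k < 2 * n) sb t e h (bb k) (bb' k) = 0.
Proof.
move=> h0; have [ht tJ ts] := EH_S20E_admissible h0; case: h0 => _ _ _ t0.
have two : (2 : C) != 0 by rewrite pnatr_eq0.
apply: (mulfI two); rewrite mulr0; under eq_bigr do rewrite sformE.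
rewrite -(trace2_low hJ hw hb _ ht tJ).
apply: (lform_ext (ext2_trace2_lform ht) (g := fun=> 0)) => [a x y|u].
  by rewrite mulr0 addr0.
by rewrite ext2_trace2_cplx // t0.
Qed.

Lemma traceless_sform t : admissible t ->
  (forall e h, inE1 J e -> \sum_(k < 2 * n) sb t e h (bb k) (bb' k) = 0) ->
  EH_S20E J w t.
Proof.
move=> ha t0; apply: (admissible_EH_S20E ha) => u; case: ha => ht tJ ts.
apply: (@complexI R); rewrite -ext2_trace2_cplx // (trace2_low hJ hw hb _ ht tJ).
have [e [e' [he he' ->]]] := eh_span hJ (cplx u).
have [l1 _ _] := low_tform w ht.
have -> : \sum_(k < 2 * n) L t (eh J e (1, 0) + eh J e' (0, 1)) (bb k) (JC 1 *m bb' k) =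
    \sum_(k < 2 * n) (sb t e (1, 0) (bb k) (bb' k) + sb t e' (0, 1) (bb k) (bb' k)).
  by apply: eq_bigr => k _; rewrite (lformD (l1 _ _)) !sformE.
have h1 := t0 e (1, 0) he; have h2 := t0 e' (0, 1) he'.
rewrite big_split /=; transitivity (2 * (0 + 0) : C); last by rewrite addr0 mulr0.
by congr (_ * (_ + _)); [exact: h1 | exact: h2].
Qed.

End Traces.

Section PureTrace.
Variable xi : 'rV[R]_(4 * n).

Definition EH_tensor := raise (trace_tensor J w (rform xi) n%:R^-1).

Let hT := trace_tensor_tform J w (rform_lform xi) n%:R^-1.
Let f := rform (cplx xi).
Let hf : lform f := rform_lform (cplx xi).
Local Notation F := (ehform J f).
Let hF h : lform (F h) := ehform_lform J h hf.

Lemma EH_tensor_admissible : admissible EH_tensor.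
Proof.
split; first exact: raise_bilinear2.
- apply: raise_quaternion_linear => // a x y z.
  exact: trace_tensorJ (rform_lform _) _ _ _ _ _.
- by apply: raise_form_skew => // x y z; exact: trace_tensor_skew.
Qed.

Lemma low_EH_tensor z1 z2 z3 :
  L EH_tensor z1 z2 z3 = trace_tensor JC (cplx w) f n%:R^-1 z1 z2 z3.
Proof.
move: z1 z2 z3; apply: low_raise => //; first exact: trace_tensor_tform.
move=> u v z; rewrite /trace_tensor /traceE /f /JC -!cplxM !bform_cplx !rform_cplx.
by rewrite !real_complexE.
Qed.

Lemma sform_EH_tensor e1 h e2 e3 : inE1 J e1 -> inE1 J e2 -> inE1 J e3 ->
  sb EH_tensor e1 h e2 e3 = g e1 e2 * F h e3 + g e1 e3 * F h e2
    - n%:R^-1 * g e2 e3 * F h e1.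
Proof.
move=> he1 he2 he3; rewrite sformE low_EH_tensor /trace_tensor.
(* Moves [J 1] from [e3] to [e2], which brings the second term of [trace_tensor] to the shape of
   [traceE_eh]. *)
have h2 := traceEJ hJC hwC hf 1 (eh J e1 h) e3 e2.
have h1 := traceE_eh hJ hw hf h he1 he2 he3.
rewrite !ehformE bEE1; congr (_ + _ - _); first exact: h1.
  apply: (etrans (congr1 -%R h2)); rewrite opprK.
  exact: (traceE_eh hJ hw hf h he1 he3 he2).
by rewrite mulrAC.
Qed.

Section DualBases.
Variables (bb bb' : 'I_(2 * n) -> VC).
Hypothesis hb : dual_bases J w bb bb'.

Lemma EH_tensor_EH_S20E : EH_S20E J w EH_tensor.
Proof.
apply: (traceless_sform hb EH_tensor_admissible) => e h he.
case: (hb) => h1 h2 _; have h3 k l := dual_bases_gform k l hb.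
under eq_bigr do rewrite sform_EH_tensor // h3 eqxx mulr1.
rewrite big_split big_split /= sumr_const card_ord.
rewrite (gE_expand hJ hw hb he (hF h)).
rewrite (gE_expand hJ hw (dual_bases_sym hJ hw hb) he (hF h)).
move: (F h e) => x; rewrite -[_ *+ (2 * n)]mulr_natr natrM.
by have n0 := nC0; field.
Qed.

(** The three terms of [sform_EH_tensor] contribute 2n (the dimension of E), 1 and -1/n. *)
Lemma EH_tensor_trace e h : inE1 J e ->
  \sum_(k < 2 * n) sb EH_tensor (bb k) h (bb' k) e =
  (2 * n%:R + 1 - n%:R^-1) * F h e.
Proof.
move=> he; case: (hb) => h1 h2 _; have h3 k l := dual_bases_gform k l hb.
under eq_bigr do rewrite sform_EH_tensor // h3 eqxx mul1r
  (gE_sym hJ hw _ e) (gE_sym hJ hw (bb' _) e) -mulrA.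
rewrite big_split big_split /= sumrN -mulr_sumr sumr_const card_ord.
rewrite (gE_expand hJ hw hb he (hF h)).
rewrite (gE_expand hJ hw (dual_bases_sym hJ hw hb) he (hF h)).
by move: (F h e) => x; rewrite -[_ *+ (2 * n)]mulr_natr natrM; ring.
Qed.

End DualBases.

Lemma EH_tensor_EH : EH J w EH_tensor.
Proof.
have [bb [bb' hb]] := exists_dual_bases hJ hw w_unit.
split; first exact: (EH_tensor_EH_S20E hb).
exists xi => e1 e2 e3 h he1 he2 he3; rewrite -sform_symb.
by rewrite sform_EH_tensor // !gform_gE !ehformE /f !rformE.
Qed.

End PureTrace.
End PureTraces.

(** * The totally E-symmetric part, and the elements of X_7 *)

Section SymmetricPart.
Local Open Scope complex_scope.
Variables (R : realType) (n : nat).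
Local Notation C := R[i].
Local Notation V := 'cV[R]_(4 * n).
Local Notation VC := 'cV[C]_(4 * n).
Variables (J : 'I_3 -> 'M[R]_(4 * n)) (w : 'M[R]_(4 * n)).
Hypotheses (n_gt0 : (0 < n)%N).
Hypotheses (hJ : quaternionic J) (hw : skew_hermitian J w) (w_unit : w \in unitmx).
Let JC (a : 'I_3) : 'M[C]_(4 * n) := cplx (J a).
Local Notation L := (low w).
Local Notation sb := (sform J w).
Let hJC : quaternionic JC := cplx_quaternionic hJ.
Implicit Types (t A : V -> V -> V) (T : V -> V -> V -> R).

Local Notation admissible := (admissible J w).
Local Notation EH_tensor := (EH_tensor J w).
Local Notation tens t := (fun u v z => bform w (t u v) z).

Lemma admissible_tform t : admissible t -> tform (tens t).
Proof.
case=> [[h1 h2] _ _]; split=> [v z a x y|u z a x y|u v].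
- by rewrite h1 bform_l.
- by rewrite h2 bform_l.
- exact: bform_r.
Qed.

Lemma admissibleJ t : admissible t -> forall a x y z,
  bform w (t x (J a *m y)) z = - bform w (t x y) (J a *m z).
Proof. by case=> _ h _ a x y z; rewrite h (bJl hJ hw). Qed.

Section Symmetrization.
Variable A : V -> V -> V.
Hypothesis hA : admissible A.

Definition sym_tensor := raise w (symE J (tens A)).

Let hT := symE_tform J (admissible_tform hA).

Lemma sym_tensor_admissible : admissible sym_tensor.
Proof.
split; first exact: raise_bilinear2.
- apply: (raise_quaternion_linear hJ hw) => // a x y z.
  by apply: (symEJ hJ (admissible_tform hA)) => *; exact: admissibleJ.
- by apply: raise_form_skew => // x y z; apply: symE_skew => // *; case: hA.
Qed.

Lemma low_sym_tensor z1 z2 z3 : L sym_tensor z1 z2 z3 = symE JC (L A) z1 z2 z3.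
Proof.
have [hA2 _ _] := hA.
move: z1 z2 z3; apply: low_raise => //.
  exact: symE_tform (low_tform w hA2).
move=> u v z; rewrite /symE /swapE /JC -!cplxM !low_cplx //.
by rewrite !real_complexE.
Qed.

Lemma sform_sym_tensor e1 h e2 e3 : inE1 J e1 -> inE1 J e2 -> inE1 J e3 ->
  sb sym_tensor e1 h e2 e3 =
  3^-1 * (sb A e1 h e2 e3 + sb A e2 h e1 e3 + sb A e3 h e1 e2).
Proof.
move=> he1 he2 he3; have [hA2 AJ _] := hA.
have hL := low_tform w hA2; have LJ := lowJ hJ hw hA2 AJ.
have h2 := swapEJ hJC hL 1 (eh J e1 h) e3 e2.
have h3 := swapE_eh hJ hL LJ h he1 he2 he3.
have h4 := swapE_eh hJ hL LJ h he1 he3 he2.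
rewrite sformE low_sym_tensor /symE !sformE.
congr (_ * (_ + _ + _)); first exact: h3.
by apply: (etrans (congr1 -%R h2)); rewrite opprK; exact: h4.
Qed.

Section DualBases.
Variables (bb bb' : 'I_(2 * n) -> VC).
Hypotheses (hb : dual_bases J w bb bb') (A0 : EH_S20E J w A).
Hypothesis A1 : forall (bb bb' : 'I_(2 * n) -> VC) e h, dual_bases J w bb bb' ->
  inE1 J e -> \sum_(k < 2 * n) sb A (bb k) h (bb' k) e = 0.

(** Of the three terms of the symmetrization, one has zero trace because [A] takes values in S^2_0
    E, the other two by [A1] applied to the pair of bases and to the reversed pair. *)
Lemma sym_tensor_EH_S20E : EH_S20E J w sym_tensor.
Proof.
apply: (traceless_sform hJ hw hb sym_tensor_admissible) => e h he.
have [h1 h2 _] := hb; have [hA2 AJ As] := hA.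
under eq_bigr => k _.
  rewrite sform_sym_tensor // (sform_sym hJ hw (bb k) h e) //.
  rewrite (sform_sym hJ hw (bb' k) h e) //.
  over.
rewrite -mulr_sumr big_split /= big_split /=.
have a1 := A1 h hb he; have a2 := A1 h (dual_bases_sym hJ hw hb) he.
have a0 := sform_traceless hJ hw hb e h A0.
transitivity (3^-1 * (0 + 0 + 0) : C); last by rewrite !addr0 mulr0.
congr (_ * (_ + _ + _)); [exact: a0|exact: a1|exact: a2].
Qed.

Lemma sym_tensor_trace e h : inE1 J e ->
  \sum_(k < 2 * n) sb sym_tensor (bb k) h (bb' k) e = 0.
Proof.
move=> he; have [h1 h2 _] := hb; have [hA2 AJ As] := hA.
under eq_bigr => k _ do rewrite sform_sym_tensor //.
rewrite -mulr_sumr big_split /= big_split /=.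
have a1 := A1 h hb he; have a2 := A1 h (dual_bases_sym hJ hw hb) he.
have a0 := sform_traceless hJ hw hb e h A0.
transitivity (3^-1 * (0 + 0 + 0) : C); last by rewrite !addr0 mulr0.
congr (_ * (_ + _ + _)); [exact: a1|exact: a2|exact: a0].
Qed.

End DualBases.
End Symmetrization.

Lemma EH_tensor_sub xi xi' u v :
  EH_tensor (xi - xi') u v = EH_tensor xi u v - EH_tensor xi' u v.
Proof.
apply: (bform_inj w_unit) => z; rewrite (lformD (bform_l _ _)) (lformN (bform_l _ _)).
rewrite !bform_raise //; try exact: trace_tensor_tform (rform_lform _) _.
rewrite /trace_tensor /traceE.
have rB x : rform (xi - xi') x = rform xi x - rform xi' x.
  by rewrite !rformE mulmxBl !mxE.
by rewrite !rB; ring.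
Qed.

Lemma EH_tensor_cyclic xi u v z :
  let T := tens (EH_tensor xi) in
  T u v z + T v z u + T z u v = - (1 + n%:R^-1) *
  (bform w u v * rform xi z + bform w v z * rform xi u + bform w z u * rform xi v).
Proof.
have hT := trace_tensor_tform J w (rform_lform xi) n%:R^-1.
by rewrite /= !bform_raise //; exact: trace_tensor_cyclic.
Qed.

(** Since [EH_tensor] is skew for [w], [pi_form] of its [delta] is twice the cyclic sum of
    [EH_tensor_cyclic], which carries the factor -2 (1 + 1/n). On [delta] of xi (x) Id it gives the
    same expression with factor 2. The coefficient n / (n + 1) makes the two cancel. *)
Lemma X7_tensor (xi : 'rV[R]_(4 * n)) :
  X7 J w (fun u v => delta (EH_tensor ((n%:R / (n%:R + 1)) *: xi)) u v +
                     delta (fun u v => covec xi u *: v) u v).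
Proof.
set xi' := _ *: xi; have [_ _ hs] := EH_tensor_admissible hJ hw w_unit xi'.
split.
  exists (delta (EH_tensor xi')), xi; split=> //.
  by exists (EH_tensor xi') => //; exact: (EH_tensor_EH n_gt0 hJ hw w_unit).
move=> u v z; have hc := EH_tensor_cyclic xi' u v z.
have rZ x : rform xi' x = (n%:R / (n%:R + 1)) * rform xi x.
  by rewrite !rformE -scalemxAl mxE.
have n0 := nR0 R n_gt0; have n1 : n%:R + 1 != 0 :> R by rewrite natr1 pnatr_eq0.
rewrite /pi_form !formvE /delta /covec -!rformE.
rewrite !(lformD (bform_l _ _)) !(lformN (bform_l _ _)) !(lformZ (bform_l _ _)).
rewrite (hs v u z) (hs z v u) (hs u z v).
have [sk _] := hw; rewrite (sk v u) (sk z v) (sk u z).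
rewrite /= !rZ in hc; move: hc.
move: (bform w (EH_tensor _ _ _) _) (bform w (EH_tensor _ _ _) _)
  (bform w (EH_tensor _ _ _) _) => a1 a2 a3 hc.
have e3 : a3 = (a3 + a2 + a1) - a2 - a1 by ring.
by rewrite hc in e3; rewrite e3; field; rewrite n1.
Qed.

End SymmetricPart.

(** * Decomposition of [delta A] into its parts in X_3, X_4, X_5 and X_7 *)

Section ImageOfDelta.
Local Open Scope complex_scope.
Variables (R : realType) (n : nat).
Local Notation C := R[i].
Local Notation V := 'cV[R]_(4 * n).
Variables (J : 'I_3 -> 'M[R]_(4 * n)) (w : 'M[R]_(4 * n)).
Hypotheses (n_gt0 : (0 < n)%N).
Hypotheses (hJ : quaternionic J) (hw : skew_hermitian J w) (w_unit : w \in unitmx).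
Let JC (a : 'I_3) : 'M[C]_(4 * n) := cplx (J a).
Local Notation sb := (sform J w).
Implicit Types (t A : V -> V -> V) (T : V -> V -> V -> R).

Local Notation admissible := (admissible J w).
Local Notation EH_tensor := (EH_tensor J w).

Definition line_tensor (xi : 'rV[R]_(4 * n)) : V -> V -> V := fun u v => rform xi u *: v.

Lemma line_tensor_admissible xi : admissible (line_tensor xi).
Proof.
split; first split.
- by move=> a u u' v; rewrite /line_tensor rform_lform scalerDl scalerA.
- by move=> a u v v'; rewrite /line_tensor scalerDr !scalerA mulrC.
- by move=> a u v; rewrite /line_tensor -scalemxAr.
- by move=> u v v'; rewrite /line_tensor !(lformZ (bform_l _ _)) hw.1 mulrN.
Qed.

Lemma trace_constant_neq0 (K : numFieldType) : 2 * n%:R + 1 - n%:R^-1 != 0 :> K.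
Proof.
have n1 : (1 : K) <= n%:R by rewrite ler1n.
have n0 : (0 : K) < n%:R by rewrite (lt_le_trans ltr01).
have n2 : n%:R^-1 <= (1 : K) by rewrite invf_le1.
by rewrite gt_eqF // -addrA ltr_pwDl ?mulr_gt0 // subr_ge0.
Qed.

Section TraceFree.
Variable A : V -> V -> V.
Hypothesis hA : EH_S20E J w A.

(** The covector sends [v] to the real trace of the endomorphism [A (.) v]; [sform_trace] identifies
    its complex extension with the E-trace. *)
Lemma exists_trace_covector : exists tau : 'rV[R]_(4 * n),
  forall bb bb' e h, dual_bases J w bb bb' -> inE1 J e ->
  \sum_(k < 2 * n) sb A (bb k) h (bb' k) e = rform (cplx tau) (eh J e h).
Proof.
have [hA2 AJ As] := EH_S20E_admissible hA.
pose tr v := \sum_(j < 4 * n) A (delta_mx j 0) v j 0.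
have htr : lform tr.
  move=> a x y; rewrite /tr mulr_sumr -big_split; apply: eq_bigr => j _ /=.
  by rewrite hA2.2 mxE [X in X + _]mxE.
exists (\row_j tr (delta_mx j 0)) => bb bb' e h hb he.
rewrite (sform_trace hJ hw hb) //.
apply: (lform_ext (ext2_trace1_lform hA2) (rform_lform _)) => u.
by rewrite ext2_trace1_cplx // rform_cplx lform_rform.
Qed.

Lemma exists_trace_free : exists xi : 'rV[R]_(4 * n),
  forall bb bb' e h, dual_bases J w bb bb' -> inE1 J e ->
  \sum_(k < 2 * n) sb (fun u v => A u v - EH_tensor xi u v) (bb k) h (bb' k) e = 0.
Proof.
have [tau htau] := exists_trace_covector.
(* The E-trace of a pure trace is [c] times its covector, by [EH_tensor_trace]. *)
pose c : R := 2 * n%:R + 1 - n%:R^-1.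
exists (c^-1 *: tau) => bb bb' e h hb he.
pose A1 u v := A u v - EH_tensor (c^-1 *: tau) u v; rewrite -/A1.
have h1 : \sum_(k < 2 * n) sb A (bb k) h (bb' k) e =
    \sum_(k < 2 * n) sb A1 (bb k) h (bb' k) e +
    \sum_(k < 2 * n) sb (EH_tensor (c^-1 *: tau)) (bb k) h (bb' k) e.
  rewrite -big_split; apply: eq_bigr => k _; apply: sform_add => u v.
  by rewrite /A1 subrK.
rewrite htau // (EH_tensor_trace hJ hw w_unit _ hb) // ehformE in h1.
have h2 z : rform (cplx (c^-1 *: tau)) z =
    (2 * n%:R + 1 - n%:R^-1)^-1 * rform (cplx tau) z.
  have -> : cplx (c^-1 *: tau) = (c^-1)%:C *: cplx tau by exact: map_mxZ.
  by rewrite !rformE -scalemxAl mxE /c !real_complexE.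
rewrite h2 mulrA mulfV ?trace_constant_neq0 // mul1r in h1.
by apply: (addIr (rform (cplx tau) (eh J e h))); rewrite add0r -h1.
Qed.

End TraceFree.

(** As [A] is symmetric in its last two E-arguments, its symmetrization is one third of its cyclic
    sum; the difference of the two therefore has zero cyclic sum, as [KH] requires. *)
Lemma KH_S30EH_split A : EH_S20E J w A ->
  (forall bb bb' e h, dual_bases J w bb bb' -> inE1 J e ->
     \sum_(k < 2 * n) sb A (bb k) h (bb' k) e = 0) ->
  S30EH J w (sym_tensor J w A) /\ KH J w (fun u v => A u v - sym_tensor J w A u v).
Proof.
move=> hA A1; have ad := EH_S20E_admissible hA; have [hA2 AJ As] := ad.
have [bb [bb' hb]] := exists_dual_bases hJ hw w_unit.
have hS := sym_tensor_EH_S20E hJ hw w_unit ad hb hA (fun bb bb' e h => @A1 bb bb' e h).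
have As' e1 h e2 e3 := sform_sym hJ hw e1 h e2 e3 hA2 AJ As.
have hK e1 h e2 e3 : sb (fun u v => A u v - sym_tensor J w A u v) e1 h e2 e3 =
    sb A e1 h e2 e3 - sb (sym_tensor J w A) e1 h e2 e3.
  rewrite (@sform_add _ _ J w A (fun u v => A u v - sym_tensor J w A u v)
    (sym_tensor J w A)).
    by rewrite addrK.
  by move=> u v; rewrite subrK.
have sS e1 h e2 e3 := @sform_sym_tensor _ _ J w hJ hw w_unit A ad e1 h e2 e3.
split.
  split; first exact: hS.
  move=> e1 e2 e3 h he1 he2 he3.
  rewrite -!sform_symb (sS e1 h e2 e3 he1 he2 he3) (sS e2 h e1 e3 he2 he1 he3).
  rewrite (As' e3 h e1 e2).
  by congr (_ * (_ + _)); exact: addrC.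
split; first exact: EH_S20E_sub hA hS.
  move=> e1 e2 e3 h he1 he2 he3.
  rewrite -!sform_symb !hK (sS e1 h e2 e3 he1 he2 he3) (sS e2 h e3 e1 he2 he3 he1).
  rewrite (sS e3 h e1 e2 he3 he1 he2).
  rewrite (As' e2 h e1 e3) (As' e3 h e2 e1) (As' e1 h e3 e2).
  have three : (3 : C) != 0 by rewrite pnatr_eq0.
  move: (sb A e1 h e2 e3) (sb A e2 h e3 e1) (sb A e3 h e1 e2) => a1 a2 a3.
  by field.
move=> cc cc' e h hc he; under eq_bigr do rewrite -sform_symb hK.
have s0 := sym_tensor_trace hJ hw w_unit ad hc hA (fun bb bb' e h => @A1 bb bb' e h) h he.
rewrite sumrB; transitivity (0 - 0 : C); last by rewrite subrr.
by congr (_ - _); [exact: A1 | exact: s0].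
Qed.

Theorem delta_in_sum A : admissible A -> in_sum J w [:: 3; 4; 5; 7]%N (delta A).
Proof.
move=> hA; have [[A1 A2] AJ As] := hA.
(* Normalized by the trace 4n of the identity, so that subtracting xi0 (x) Id leaves trace-free
   endomorphisms. *)
pose tr u := (4 * n)%:R^-1 * \sum_(k < 4 * n) A u (delta_mx k 0) k 0.
have htr : lform tr.
  move=> a x y; rewrite /tr mulrCA -mulrDr; congr (_ * _).
  rewrite mulr_sumr -big_split; apply: eq_bigr => j _ /=.
  by rewrite A1 mxE [X in X + _]mxE.
pose xi0 := \row_j tr (delta_mx j 0).
pose A0 u v := A u v - line_tensor xi0 u v.
have n0 : (4 * n)%:R != 0 :> R by rewrite pnatr_eq0 muln_eq0 -lt0n.
have hA0 : EH_S20E J w A0.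
  apply: admissible_EH_S20E; first exact: admissible_sub (line_tensor_admissible xi0).
  move=> u; rewrite /A0 /line_tensor (lform_rform htr).
  have -> : \sum_(k < 4 * n) (A u (delta_mx k 0) - tr u *: delta_mx k 0) k 0 =
    \sum_(k < 4 * n) (A u (delta_mx k 0) k 0 - tr u).
    by apply: eq_bigr => k _; rewrite !mxE !eqxx mulr1.
  rewrite sumrB sumr_const card_ord -[_ *+ _]mulr_natl /tr mulrA mulfV // mul1r.
  by rewrite subrr.
have [xi1 hxi1] := exists_trace_free hA0.
have hE xi := EH_tensor_EH n_gt0 hJ hw w_unit xi.
pose B u v := A0 u v - EH_tensor xi1 u v.
have hB : EH_S20E J w B by apply: EH_S20E_sub => //; case: (hE xi1).
have [hS hK] := KH_S30EH_split hB hxi1.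
(* The X_7 element built from [xi0] contains [delta (EH_tensor xi2)], which is taken out of the X_4
   part; this leaves the covector [xi1 - xi2] there. *)
pose xi2 := (n%:R / (n%:R + 1)) *: xi0.
exists (fun k => match k with
  | 3%N => delta (fun u v => B u v - sym_tensor J w B u v)
  | 4%N => delta (EH_tensor (xi1 - xi2))
  | 5%N => delta (sym_tensor J w B)
  | _ => fun u v => delta (EH_tensor xi2) u v + delta (fun u v => covec xi0 u *: v) u v
  end); split.
  move=> k; rewrite !inE => /or4P[] /eqP ->.
  - by exists (fun u v => B u v - sym_tensor J w B u v).
  - by exists (EH_tensor (xi1 - xi2)).
  - by exists (sym_tensor J w B).
  - exact: X7_tensor.
move=> u v; rewrite !big_cons big_nil /= addr0.
rewrite /delta !EH_tensor_sub // /B /A0 /line_tensor /covec -!rformE.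
move: (EH_tensor xi1 u v) (EH_tensor xi1 v u) (EH_tensor xi2 u v) (EH_tensor xi2 v u).
move: (sym_tensor _ _ _ _ _) (sym_tensor _ _ _ _ _) (A u v) (A v u).
move: (_ *: v) (_ *: u) => c c' s s' a a' x x' y y'.
apply/colP => i; rewrite !mxE; ring.
Qed.

End ImageOfDelta.

(** * The S^3H part contains no nonzero [delta B] with [B] commuting with the [J a] *)

Section Uniqueness.
Local Open Scope complex_scope.
Variables (R : realType) (n : nat).
Local Notation C := R[i].
Local Notation V := 'cV[R]_(4 * n).
Local Notation VC := 'cV[C]_(4 * n).
Variables (J : 'I_3 -> 'M[R]_(4 * n)) (w : 'M[R]_(4 * n)).
Hypotheses (hJ : quaternionic J) (hw : skew_hermitian J w) (w_unit : w \in unitmx).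
Let JC (a : 'I_3) : 'M[C]_(4 * n) := cplx (J a).
Local Notation b := (bform (cplx w)).
Local Notation L := (low w).
Implicit Types (t A : V -> V -> V) (T : V -> V -> V -> R).

Lemma lower_low t e1 h1 e2 h2 e3 h3 :
  lower J w t e1 h1 e2 h2 e3 h3 = L t (eh J e1 h1) (eh J e2 h2) (eh J e3 h3).
Proof. by rewrite lowE /lower formCE. Qed.

Lemma low_add t t1 t2 z1 z2 z3 : (forall u v, t u v = t1 u v + t2 u v) ->
  L t z1 z2 z3 = L t1 z1 z2 z3 + L t2 z1 z2 z3.
Proof. by move=> ht; rewrite !lowE (ext2_add _ _ ht) (lformD (bform_l _ _)). Qed.

Lemma low_flip t t' z1 z2 z3 : (forall u v, t u v = t' v u) ->
  L t z1 z2 z3 = L t' z2 z1 z3.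
Proof.
move=> ht; rewrite !lowE; congr (b _ _); apply/colP => i.
by rewrite !ext2_coord !ht; congr (Complex _ _); rewrite !mxE addrC.
Qed.

Lemma low_opp t t' z1 z2 z3 : (forall u v, t u v = - t' u v) ->
  L t z1 z2 z3 = - L t' z1 z2 z3.
Proof.
move=> ht; rewrite !lowE -(lformN (bform_l _ _)); congr (b _ _); apply/colP => i.
rewrite [RHS]mxE !ext2_coord !ht !mxE.
by apply/eqP; rewrite eq_complex /=; apply/andP; split; apply/eqP; ring.
Qed.

Lemma low_delta t A z1 z2 z3 : (forall u v, t u v = delta A u v) ->
  L t z1 z2 z3 = L A z1 z2 z3 - L A z2 z1 z3.
Proof.
move=> ht; rewrite (@low_add t A (fun u v => - A v u)) //; congr (_ + _).
by rewrite (@low_opp _ (fun u v => A v u)) // (@low_flip _ A).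
Qed.

Lemma eh_add e h h' : eh J e (h.1 + h'.1, h.2 + h'.2) = eh J e h + eh J e h'.
Proof. by rewrite /eh /= !scalerDl addrACA. Qed.

Lemma lform_eh_eq0 (f : VC -> C) : lform f ->
  (forall e h, inE1 J e -> f (eh J e h) = 0) -> forall z, f z = 0.
Proof.
move=> hf f0 z; have [e [e' [he he' ->]]] := eh_span hJ z.
rewrite (lformD hf); transitivity (0 + 0 : C); last exact: addr0.
by congr (_ + _); [exact: f0 he | exact: f0 he'].
Qed.

Lemma lower_eq0 t : bilinear2 t ->
  (forall e1 h1 e2 h2 e3 h3, inE1 J e1 -> inE1 J e2 -> inE1 J e3 ->
    lower J w t e1 h1 e2 h2 e3 h3 = 0) ->
  forall u v, t u v = 0.
Proof.
move=> ht t0 u v; apply: (bform_inj w_unit) => z; rewrite (lform0 (bform_l _ _)).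
apply: (@complexI R); rewrite -low_cplx //.
have [l1 l2 l3] := low_tform w ht.
move: (cplx u) (cplx v) (cplx z) => {u v z} z1 z2 z3.
apply: (lform_eh_eq0 (l1 z2 z3)) => e1 h1 he1.
apply: (lform_eh_eq0 (l2 _ z3)) => e2 h2 he2.
apply: (lform_eh_eq0 (l3 _ _)) => e3 h3 he3.
by rewrite -lower_low t0.
Qed.

(** The property shared by X_3, X_4, X_5 and X_7 through which both integrability and uniqueness are
    proved. *)
Definition delta_commuting t := exists A : V -> V -> V,
  [/\ bilinear2 A, quaternion_linear J A & forall u v, t u v = delta A u v].

Lemma delta_commuting_add t1 t2 t : delta_commuting t1 -> delta_commuting t2 ->
  (forall u v, t u v = t1 u v + t2 u v) -> delta_commuting t.
Proof.
move=> [A1 [[l1 r1] J1 h1]] [A2 [[l2 r2] J2 h2]] ht.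
exists (fun u v => A1 u v + A2 u v); split; first split.
- by move=> a x y z; rewrite l1 l2 scalerDr addrACA.
- by move=> a x y z; rewrite r1 r2 scalerDr addrACA.
- by move=> a u v; rewrite J1 J2 mulmxDr.
- by move=> u v; rewrite ht h1 h2 /delta opprD addrACA.
Qed.

Lemma delta_commuting_opp t t' : delta_commuting t ->
  (forall u v, t' u v = - t u v) -> delta_commuting t'.
Proof.
move=> [A1 [[l1 r1] J1 h1]] ht.
exists (fun u v => - A1 u v); split; first split.
- by move=> a x y z; rewrite l1 opprD scalerN.
- by move=> a x y z; rewrite r1 opprD scalerN.
- by move=> a u v; rewrite J1 mulmxN.
- by move=> u v; rewrite ht h1 /delta opprB opprK addrC.
Qed.

Lemma X_delta_commuting k t : k \in [:: 3; 4; 5; 7]%N -> X_ J w k t ->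
  delta_commuting t.
Proof.
have EHd P : (forall A, P A -> EH_S20E J w A) -> forall t, image_delta P t ->
    delta_commuting t.
  by move=> hP t' [A /hP [h1 h2 _ _] ht]; exists A.
rewrite !inE => /or4P[] /eqP -> /=.
- by apply: EHd => A [].
- by apply: EHd => A [].
- by apply: EHd => A [].
case=> [[t4 [xi [h4 ht]]] _].
apply: delta_commuting_add ht; first by apply: EHd h4 => A [].
exists (fun u v => covec xi u *: v); split=> //; first split.
- by move=> a u u' v; rewrite /covec -!rformE rform_lform scalerDl scalerA.
- by move=> a u v v'; rewrite scalerDr !scalerA mulrC.
- by move=> a u v; rewrite -scalemxAr.
Qed.

(* [lower (delta A)] is a combination of eps h2 h3 and eps h1 h3, so it vanishes
   when the three H-arguments coincide; being symmetric in them, it is zero. *)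
Lemma S3H_delta_commuting t : S3H_part J w t -> delta_commuting t ->
  forall u v, t u v = 0.
Proof.
move=> [[ht tskew] tsym] [A [hA AJ tA]].
apply: lower_eq0 => // e1 x e2 y e3 z he1 he2 he3; rewrite lower_low.
pose F h1 h2 h3 := L t (eh J e1 h1) (eh J e2 h2) (eh J e3 h3).
have Fs12 h1 h2 h3 : F h1 h2 h3 = F h2 h1 h3.
  by rewrite /F -!lower_low; have [-> _] := tsym e1 e2 e3 h1 h2 h3 he1 he2 he3.
have Fs23 h1 h2 h3 : F h1 h2 h3 = F h1 h3 h2.
  by rewrite /F -!lower_low; have [_ ->] := tsym e1 e2 e3 h1 h2 h3 he1 he2 he3.
have FE h1 h2 h3 : F h1 h2 h3 =
    (h2.1 * h3.2 - h2.2 * h3.1) * sform J w A e1 h1 e2 e3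
    - (h1.1 * h3.2 - h1.2 * h3.1) * sform J w A e2 h2 e1 e3.
  by rewrite /F (low_delta _ _ _ tA) -!lower_low !(lower_sform hJ hw).
have three : (3 : C) != 0 by rewrite pnatr_eq0.
have two : (2 : C) != 0 by rewrite pnatr_eq0.
(* By [FE] the three placements of [h'] among two copies of [h] sum to zero, and by symmetry they
   are equal. *)
have F0 h h' : F h h h' = 0.
  have id : F h h h' = - F h h' h - F h' h h by rewrite !FE; ring.
  rewrite -(Fs12 h h' h) -(Fs23 h h h') in id.
  move: (F h h h') id => X id; apply: (mulfI three); rewrite mulr0.
  have -> : 3 * X = X - (- X - X) by ring.
  by rewrite -id subrr.
have [l1 l2 _] := low_tform w ht.
have Fl h h' h2 : F (h.1 + h'.1, h.2 + h'.2) h2 z = F h h2 z + F h' h2 z.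
  by rewrite /F eh_add (lformD (l1 _ _)).
have Fr h h' h1 : F h1 (h.1 + h'.1, h.2 + h'.2) z = F h1 h z + F h1 h' z.
  by rewrite /F eh_add (lformD (l2 _ _)).
(* Polarization in the first two H-arguments: the expansion leaves twice [F x y z]. *)
have := F0 (x.1 + y.1, x.2 + y.2) z.
rewrite Fl !Fr (F0 x z) (F0 y z) (Fs12 y x z) -/(F x y z) add0r addr0.
move: (F x y z) => X h; apply: (mulfI two); rewrite mulr0 -h; ring.
Qed.

End Uniqueness.

(** * Independence of X_1, X_2 and X_6, and uniqueness of these components *)

Section DirectSum.
Local Open Scope complex_scope.
Variables (R : realType) (n : nat).
Local Notation C := R[i].
Local Notation V := 'cV[R]_(4 * n).
Local Notation VC := 'cV[C]_(4 * n).
Variables (J : 'I_3 -> 'M[R]_(4 * n)) (w : 'M[R]_(4 * n)).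
Hypotheses (n_gt0 : (0 < n)%N).
Hypotheses (hJ : quaternionic J) (hw : skew_hermitian J w) (w_unit : w \in unitmx).
Let JC (a : 'I_3) : 'M[C]_(4 * n) := cplx (J a).
Local Notation g := (gform J w).
Local Notation L := (low w).
Implicit Types (t A : V -> V -> V) (T : V -> V -> V -> R).

Definition lower_locked :
    (V -> V -> V) -> VC -> C * C -> VC -> C * C -> VC -> C * C -> C :=
  locked_with lock_key (lower J w).
Local Notation lw := lower_locked.

Lemma lw_lower : lw = lower J w.
Proof. by rewrite /lower_locked unlock. Qed.

Lemma gform_fun : g = gE J w.
Proof. by rewrite /gform unlock. Qed.

Lemma lower_lockedE t e1 h1 e2 h2 e3 h3 :
  lw t e1 h1 e2 h2 e3 h3 = lower J w t e1 h1 e2 h2 e3 h3.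
Proof. by rewrite lw_lower. Qed.

Lemma lw_low t e1 h1 e2 h2 e3 h3 :
  lw t e1 h1 e2 h2 e3 h3 = L t (eh J e1 h1) (eh J e2 h2) (eh J e3 h3).
Proof. by rewrite lower_lockedE lower_low. Qed.

Lemma lw_sub t t1 t2 e1 h1 e2 h2 e3 h3 : (forall u v, t u v = t1 u v - t2 u v) ->
  lw t e1 h1 e2 h2 e3 h3 = lw t1 e1 h1 e2 h2 e3 h3 - lw t2 e1 h1 e2 h2 e3 h3.
Proof.
move=> ht; rewrite !lw_low (@low_add _ _ w t t1 (fun u v => - t2 u v)) //; congr (_ + _).
exact: (@low_opp _ _ w _ t2).
Qed.

Lemma S3H_partP t : S3H_part J w t <-> skew2 t /\
  forall (e1 e2 e3 : VC) (h1 h2 h3 : C * C), inE1 J e1 -> inE1 J e2 -> inE1 J e3 ->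
    lw t e1 h1 e2 h2 e3 h3 = lw t e1 h2 e2 h1 e3 h3 /\
    lw t e1 h1 e2 h2 e3 h3 = lw t e1 h1 e2 h3 e3 h2.
Proof. by rewrite lw_lower. Qed.

Lemma X1P t : X1 J w t <-> [/\ S3H_part J w t,
      forall (e1 e2 e3 : VC) (h1 h2 h3 : C * C), inE1 J e1 -> inE1 J e2 -> inE1 J e3 ->
        lw t e1 h1 e2 h2 e3 h3 + lw t e2 h1 e3 h2 e1 h3
        + lw t e3 h1 e1 h2 e2 h3 = 0
    & forall (bb bb' : 'I_(2 * n) -> VC) (e : VC) (h1 h2 h3 : C * C),
        dual_bases J w bb bb' -> inE1 J e ->
        \sum_(k < 2 * n) lw t (bb k) h1 e h2 (bb' k) h3 = 0].
Proof. by rewrite lw_lower. Qed.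

Lemma X2P t : X2 J w t <-> S3H_part J w t /\
  forall (e1 e2 e3 : VC) (h1 h2 h3 : C * C), inE1 J e1 -> inE1 J e2 -> inE1 J e3 ->
    lw t e1 h1 e2 h2 e3 h3 = - lw t e1 h1 e3 h2 e2 h3.
Proof. by rewrite lw_lower. Qed.

Lemma X6P t : X6 J w t <-> S3H_part J w t /\
  exists theta : VC -> C * C -> C * C -> C * C -> C,
    forall (e1 e2 e3 : VC) (h1 h2 h3 : C * C), inE1 J e1 -> inE1 J e2 -> inE1 J e3 ->
      lw t e1 h1 e2 h2 e3 h3 =
      g e1 e3 * theta e2 h1 h2 h3 - g e2 e3 * theta e1 h1 h2 h3.
Proof. by rewrite lw_lower gform_fun. Qed.

Section Sub.
Variables t t1 t2 : V -> V -> V.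
Hypothesis ht : forall u v, t u v = t1 u v - t2 u v.

Let lws := fun e1 h1 e2 h2 e3 h3 => @lw_sub t t1 t2 e1 h1 e2 h2 e3 h3 ht.

Lemma S3H_part_sub : S3H_part J w t1 -> S3H_part J w t2 -> S3H_part J w t.
Proof.
move=> /S3H_partP [[[l1 r1] s1] h1] /S3H_partP [[[l2 r2] s2] h2].
apply/S3H_partP; split; first split; first split.
- by move=> a x y z; rewrite !ht l1 l2 scalerBr opprD addrACA.
- by move=> a x y z; rewrite !ht r1 r2 scalerBr opprD addrACA.
- by move=> u v; rewrite !ht s1 s2 opprB opprK addrC.
move=> e1 e2 e3 k1 k2 k3 he1 he2 he3; rewrite !lws.
have [a1 b1] := h1 e1 e2 e3 k1 k2 k3 he1 he2 he3.
have [a2 b2] := h2 e1 e2 e3 k1 k2 k3 he1 he2 he3.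
by split; [rewrite a1 a2 | rewrite b1 b2].
Qed.

Lemma X1_sub : X1 J w t1 -> X1 J w t2 -> X1 J w t.
Proof.
move=> /X1P [s1 h1 k1] /X1P [s2 h2 k2]; apply/X1P; split.
- exact: S3H_part_sub.
- move=> e1 e2 e3 a1 a2 a3 he1 he2 he3; rewrite !lws.
  have := h1 e1 e2 e3 a1 a2 a3 he1 he2 he3; have := h2 e1 e2 e3 a1 a2 a3 he1 he2 he3.
  move: (lw t1 _ _ _ _ _ _) (lw t1 _ _ _ _ _ _) (lw t1 _ _ _ _ _ _).
  move: (lw t2 _ _ _ _ _ _) (lw t2 _ _ _ _ _ _) (lw t2 _ _ _ _ _ _).
  move=> x1 x2 x3 y1 y2 y3 hx hy.
  by rewrite -[RHS](subrr 0) -{1}hy -hx; ring.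
- move=> bb bb' e a1 a2 a3 hb he; under eq_bigr do rewrite lws.
  by rewrite sumrB k1 // k2 // subrr.
Qed.

Lemma X2_sub : X2 J w t1 -> X2 J w t2 -> X2 J w t.
Proof.
move=> /X2P [s1 h1] /X2P [s2 h2]; apply/X2P; split; first exact: S3H_part_sub.
by move=> e1 e2 e3 a1 a2 a3 he1 he2 he3; rewrite !lws h1 // h2 // opprD.
Qed.

Lemma X6_sub : X6 J w t1 -> X6 J w t2 -> X6 J w t.
Proof.
move=> /X6P [s1 [th1 h1]] /X6P [s2 [th2 h2]]; apply/X6P.
split; first exact: S3H_part_sub.
exists (fun e a1 a2 a3 => th1 e a1 a2 a3 - th2 e a1 a2 a3).
by move=> e1 e2 e3 a1 a2 a3 he1 he2 he3; rewrite lws h1 // h2 //; ring.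
Qed.

End Sub.

Lemma lw_zero e1 h1 e2 h2 e3 h3 : lw (fun _ _ => 0) e1 h1 e2 h2 e3 h3 = 0.
Proof.
by rewrite (@lw_sub _ (fun _ _ => 0) (fun _ _ => 0)) ?subrr // => u v; rewrite subrr.
Qed.

Lemma zero_S3H : S3H_part J w (fun _ _ => 0).
Proof.
apply/S3H_partP; split.
  by split; [split=> *; rewrite scaler0 addr0|move=> *; rewrite oppr0].
by move=> e1 e2 e3 h1 h2 h3 _ _ _; rewrite !lw_zero.
Qed.

Lemma S3H_part_add t t1 t2 : (forall u v, t u v = t1 u v + t2 u v) ->
  S3H_part J w t1 -> S3H_part J w t2 -> S3H_part J w t.
Proof.
move=> ht h1 h2.
have h3 : S3H_part J w (fun u v => 0 - t2 u v).
  exact: (S3H_part_sub (fun u v => erefl) zero_S3H h2).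
apply: (S3H_part_sub _ h1 h3) => u v.
by rewrite ht sub0r opprK.
Qed.

(** Skewness of [t] exchanges the pairs (e1, h1) and (e2, h2); symmetry in the H-arguments puts [h1]
    and [h2] back. *)
Lemma lw_skew t e1 h1 e2 h2 e3 h3 : S3H_part J w t ->
  inE1 J e1 -> inE1 J e2 -> inE1 J e3 ->
  lw t e1 h1 e2 h2 e3 h3 = - lw t e2 h1 e1 h2 e3 h3.
Proof.
move=> /S3H_partP [[_ ts] th] he1 he2 he3.
have [-> _] := th e1 e2 e3 h1 h2 h3 he1 he2 he3.
rewrite !lw_low.
transitivity (- L (fun u v => t v u) (eh J e1 h2) (eh J e2 h1) (eh J e3 h3)).
  exact: low_opp.
by congr (- _); exact: low_flip.
Qed.

Lemma lw_eq0 t : S3H_part J w t ->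
  (forall e1 h1 e2 h2 e3 h3, inE1 J e1 -> inE1 J e2 -> inE1 J e3 ->
    lw t e1 h1 e2 h2 e3 h3 = 0) ->
  forall u v, t u v = 0.
Proof.
move=> [[ht _] _] h; apply: (lower_eq0 hJ w_unit ht) => *.
by rewrite -lower_lockedE h.
Qed.

(** The E-trace of a pure trace is (2n - 1) times its [theta], and 2n is not 1. *)
Lemma pure_trace_eq0 t : X6 J w t ->
  (forall bb bb' e h1 h2 h3, dual_bases J w bb bb' -> inE1 J e ->
        \sum_(k < 2 * n) lw t (bb k) h1 e h2 (bb' k) h3 = 0) ->
  forall u v, t u v = 0.
Proof.
move=> /X6P [hS [th hth]] tr; have [[ht _] _] := hS.
have [l1 l2 l3] := low_tform w ht.
have [bb [bb' hb]] := exists_dual_bases hJ hw w_unit.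
have [h1 h2 _] := hb; have h3 k l := dual_bases_gform k l hb.
have n2 : (0 < 2 * n)%N by rewrite muln_gt0.
pose k0 := Ordinal n2.
suff th0 e a1 a2 a3 : inE1 J e -> th e a1 a2 a3 = 0.
  apply: lw_eq0 => // e1 a1 e2 a2 e3 a3 he1 he2 he3.
  by rewrite hth // !th0 // !mulr0 subrr.
move=> he.
(* [X6] gives [theta] as a mere function. Evaluating the pure trace formula on one dual pair shows
   that on E it agrees with the linear form [Th], to which [gE_expand] applies. *)
pose Th z := ehform J (fun x => L t (eh J (bb k0) a1) x (eh J (bb' k0) a3)) a2 z
  + th (bb k0) a1 a2 a3 * g z (bb' k0).
have hTh : lform Th.
  move=> a x y; rewrite /Th ehform_lform // gE_lin; ring.
have ThE z : inE1 J z -> th z a1 a2 a3 = Th z.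
  move=> hz; have := hth (bb k0) z (bb' k0) a1 a2 a3 (h1 k0) hz (h2 k0).
  rewrite h3 eqxx mul1r lw_low /Th ehformE => ->.
  by rewrite mulrC subrK.
have := tr bb bb' e a1 a2 a3 hb he.
under eq_bigr => k _.
  rewrite hth // h3 eqxx mul1r (ThE _ he) (ThE _ (h1 k)).
  over.
rewrite sumrB (gE_expand hJ hw hb he hTh) sumr_const card_ord -ThE //.
move: (th e a1 a2 a3) => x; rewrite -mulr_natl -[X in _ - X]mul1r -mulrBl => /eqP.
rewrite mulf_eq0 => /orP [|/eqP //]; rewrite subr_eq0 pnatr_eq1.
by case: n n_gt0 => [|[|?]].
Qed.

(** The cyclic sum over E kills [t1] by definition and [t6] because gE is symmetric, and it triples
    [t2], which is alternating; so [t2] is zero. Then [t6], being - [t1], has no E-trace. *)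
Lemma X126_direct t1 t2 t6 : X1 J w t1 -> X2 J w t2 -> X6 J w t6 ->
  (forall u v, t1 u v + t2 u v + t6 u v = 0) ->
  [/\ forall u v, t1 u v = 0, forall u v, t2 u v = 0 & forall u v, t6 u v = 0].
Proof.
move=> H1 H2 H6 h.
have [S1 c1 tr1] := (X1P t1).1 H1; have [S2 s2] := (X2P t2).1 H2.
have [S6 [th hth]] := (X6P t6).1 H6.
have e6 u v : t6 u v = (fun u v => - t1 u v) u v - t2 u v.
  by rewrite -opprD; apply/eqP; rewrite -addr_eq0 addrC h.
have E e1 k1 e2 k2 e3 k3 : lw t6 e1 k1 e2 k2 e3 k3 =
    - lw t1 e1 k1 e2 k2 e3 k3 - lw t2 e1 k1 e2 k2 e3 k3.
  rewrite (lw_sub _ _ _ _ _ _ e6); congr (_ - _).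
  by rewrite !lw_low; exact: low_opp.
have three : (3 : C) != 0 by rewrite pnatr_eq0.
have t20 : forall u v, t2 u v = 0.
  apply: lw_eq0 => // e1 k1 e2 k2 e3 k3 he1 he2 he3.
  have C1 := c1 e1 e2 e3 k1 k2 k3 he1 he2 he3.
  have r2 : lw t2 e2 k1 e3 k2 e1 k3 = lw t2 e1 k1 e2 k2 e3 k3.
    by rewrite s2 // lw_skew // opprK.
  have r3 : lw t2 e3 k1 e1 k2 e2 k3 = lw t2 e1 k1 e2 k2 e3 k3.
    by rewrite lw_skew // s2 // opprK.
  have c6 : lw t6 e1 k1 e2 k2 e3 k3 + lw t6 e2 k1 e3 k2 e1 k3
      + lw t6 e3 k1 e1 k2 e2 k3 = 0.
    rewrite !hth // (gE_sym hJ hw e2 e1) (gE_sym hJ hw e3 e1) (gE_sym hJ hw e3 e2).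
    ring.
  rewrite !E r2 r3 in c6; move: C1 c6.
  move: (lw t2 _ _ _ _ _ _) (lw t1 _ _ _ _ _ _) (lw t1 _ _ _ _ _ _) (lw t1 _ _ _ _ _ _).
  move=> x y1 y2 y3 C1 c6; apply: (mulfI three); rewrite mulr0 -[RHS]oppr0 -c6.
  by rewrite -[LHS]addr0 -C1; ring.
have E' e1 k1 e2 k2 e3 k3 : inE1 J e1 -> inE1 J e2 -> inE1 J e3 ->
    lw t6 e1 k1 e2 k2 e3 k3 = - lw t1 e1 k1 e2 k2 e3 k3.
  move=> he1 he2 he3; rewrite !lw_low; apply: low_opp => u v.
  by rewrite e6 t20 subr0.
have t60 : forall u v, t6 u v = 0.
  apply: pure_trace_eq0 => // bb bb' e k1 k2 k3 hb he; have [h1 h2 _] := hb.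
  under eq_bigr do rewrite E' //.
  by rewrite sumrN tr1 // oppr0.
split=> // u v; have := h u v; rewrite t20 t60 !addr0; exact.
Qed.

(** The differences in X_1, X_2 and X_6 add up to a tensor [T] of the S^3H part, which is minus the
    sum of the other differences and so of the form [delta B]. Hence [T] is zero and [X126_direct]
    applies. *)
Lemma decomposition_unique t s s' :
  decomposition J w (iota 1 7) s t -> decomposition J w (iota 1 7) s' t ->
  forall u v, [/\ s 1%N u v = s' 1%N u v, s 2%N u v = s' 2%N u v & s 6%N u v = s' 6%N u v].
Proof.
move=> [hs ht] [hs' ht'].
pose d k u v := s k u v - s' k u v.
have X1d : X1 J w (d 1%N) by apply: X1_sub (hs 1%N isT) (hs' 1%N isT).
have X2d : X2 J w (d 2%N) by apply: X2_sub (hs 2%N isT) (hs' 2%N isT).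
have X6d : X6 J w (d 6%N) by apply: X6_sub (hs 6%N isT) (hs' 6%N isT).
have [S1 _ _] := X1d; have [S2 _] := X2d; have [S6 _] := X6d.
pose T u v := d 1%N u v + d 2%N u v + d 6%N u v.
have ST : S3H_part J w T.
  exact: (S3H_part_add (fun u v => erefl) (S3H_part_add (fun u v => erefl) S1 S2) S6).
have dk k : k \in [:: 3; 4; 5; 7]%N -> delta_commuting J (d k).
  move=> hk; have hk' : k \in iota 1 7.
    by move: hk; rewrite !inE => /or4P[] /eqP ->.
  apply: (delta_commuting_add (X_delta_commuting hk (hs k hk'))
    (delta_commuting_opp (X_delta_commuting hk (hs' k hk')) (fun u v => erefl))).
  by [].
have dT : delta_commuting J T.
  apply: (@delta_commuting_opp _ _ J
    (fun u v => d 3%N u v + d 4%N u v + (d 5%N u v + d 7%N u v))).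
    apply: delta_commuting_add (fun u v => erefl).
      exact: delta_commuting_add (dk 3%N isT) (dk 4%N isT) (fun u v => erefl).
    exact: delta_commuting_add (dk 5%N isT) (dk 7%N isT) (fun u v => erefl).
  move=> u v; apply/eqP; rewrite -addr_eq0; apply/eqP.
  have := ht u v; rewrite ht' /= !big_cons !big_nil /T /d !addr0 => e.
  move: (s 1%N u v) (s 2%N u v) (s 3%N u v) (s 4%N u v) (s 5%N u v) (s 6%N u v)
    (s 7%N u v) e.
  move: (s' 1%N u v) (s' 2%N u v) (s' 3%N u v) (s' 4%N u v) (s' 5%N u v)
    (s' 6%N u v) (s' 7%N u v).
  move=> b1 b2 b3 b4 b5 b6 b7 a1 a2 a3 a4 a5 a6 a7.
  move/(congr1 (fun x => x - (b1 + (b2 + (b3 + (b4 + (b5 + (b6 + b7)))))))).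
  rewrite subrr => e; apply/esym/(etrans e); apply/colP => i; rewrite !mxE; ring.
have T0 := S3H_delta_commuting hJ hw w_unit ST dT.
have [d1 d2 d6] := X126_direct X1d X2d X6d T0.
move=> u v; have := d1 u v; have := d2 u v; have := d6 u v; rewrite /d.
by move=> /eqP; rewrite subr_eq0 => /eqP -> /eqP; rewrite subr_eq0 => /eqP -> /eqP;
  rewrite subr_eq0 => /eqP ->.
Qed.

(** Each hypothesis brings its own decomposition; uniqueness transfers the last two vanishings to
    the first one. *)
Lemma components_vanish_in_sum t :
  component J w 1 t (fun _ _ => 0) -> component J w 2 t (fun _ _ => 0) ->
  component J w 6 t (fun _ _ => 0) -> in_sum J w [:: 3; 4; 5; 7]%N t.
Proof.
move=> [s hs s1] [s' hs' s2] [s'' hs'' s6]; exists s; split=> [k hk|u v].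
  by apply: hs.1; move: hk; rewrite !inE => /or4P[] /eqP ->.
have [_ e2 _] := decomposition_unique hs hs' u v.
have [_ _ e6] := decomposition_unique hs hs'' u v.
by rewrite hs.2 /= !big_cons !big_nil e2 e6 s1 s2 s6 !add0r.
Qed.

Lemma in_sum_components_vanish t : in_sum J w [:: 3; 4; 5; 7]%N t ->
  [/\ component J w 1 t (fun _ _ => 0), component J w 2 t (fun _ _ => 0)
    & component J w 6 t (fun _ _ => 0)].
Proof.
move=> [s [hs ht]].
(* The values of [s] at 1, 2 and 6 are unconstrained, so they are reset to zero. *)
pose s0 k := if k \in [:: 1; 2; 6]%N then (fun _ _ => 0) else s k.
have h0 : decomposition J w (iota 1 7) s0 t.
  split=> [k|u v]; last by rewrite ht /= !big_cons !big_nil /s0 /= !add0r.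
  have S0 := zero_S3H.
  have z1 : X1 J w (fun _ _ => 0).
    apply/X1P; split=> // *; first by rewrite !lw_zero !addr0.
    by rewrite big1 // => *; rewrite lw_zero.
  have z2 : X2 J w (fun _ _ => 0).
    by apply/X2P; split=> // *; rewrite !lw_zero oppr0.
  have z6 : X6 J w (fun _ _ => 0).
    apply/X6P; split=> //; exists (fun _ _ _ _ => 0) => *.
    by rewrite lw_zero !mulr0 subrr.
  rewrite !inE => /or4P [||| /or4P []] /eqP ->; rewrite /s0 /=.
  - exact: z1.
  - exact: z2.
  - exact: (hs 3%N isT).
  - exact: (hs 4%N isT).
  - exact: (hs 5%N isT).
  - exact: z6.
  - exact: (hs 7%N isT).
by split; exists s0.
Qed.

End DirectSum.

(** * Smoothness and derivatives of matrix fields applied to vectors *)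

Section Smooth.
Variables (R : realType) (m : nat).
Local Notation V := 'cV[R]_m.

Lemma continuous_mulmxr (v : V) : continuous (fun A : 'M[R]_m => A *m v).
Proof.
rewrite (_ : (fun A : 'M[R]_m => A *m v) =
  (fun A => \sum_i \sum_j A i j *: (v j 0 *: delta_mx i 0))); last first.
  apply/funext => B; apply/colP => k; rewrite mxE summxE [RHS](bigD1 k) //= summxE.
  rewrite [X in _ = _ + X]big1 ?addr0 => [|i ik].
    by apply: eq_bigr => j _; rewrite !mxE !eqxx mulr1.
  by rewrite summxE big1 // => j _; rewrite !mxE [k == _]eq_sym (negPf ik) /= !mulr0.
apply: continuous_big => [|i _]; first exact: add_continuous.
apply: continuous_big => [|j _]; first exact: add_continuous.
move=> A; have h : (fun B : 'M[R]_m => B i j) @ A --> A i j by exact: coord_continuous.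
exact: cvgZr_tmp h.
Qed.

Lemma is_derive_mulmxr (F : V -> 'M[R]_m) (v u x : V) : derivable F x u ->
  is_derive x u (fun y => F y *m v) ('D_u F x *m v).
Proof.
move=> dF.
have h : (fun h : R => h^-1 *: (((fun y => F y *m v) \o shift x) (h *: u) - F x *m v)) @ 0^'
    --> 'D_u F x *m v.
  rewrite (_ : (fun h : R => _) =
    (fun A => A *m v) \o (fun h : R => h^-1 *: ((F \o shift x) (h *: u) - F x))).
    by apply: continuous_cvg; [exact: continuous_mulmxr | exact: dF].
  by apply/funext => h /=; rewrite -mulmxBl scalemxAl.
by apply: DeriveDef; [apply/cvg_ex; eexists; exact: h | exact: cvg_lim h].
Qed.

Lemma near_open (U : set V) (T : Type) (f g : V -> T) (x : V) : open U -> U x ->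
  (forall y, U y -> f y = g y) -> \near x, f x = g x.
Proof.
move=> Uo Ux h; near=> y; apply: h; near: y.
by apply: open_nbhs_nbhs; split.
Unshelve. all: by end_near. Qed.

(** Makes [J a] applied to a constant field available as a smooth test field. *)
Lemma smooth_on_mulmxr (U : set V) (F : V -> 'M[R]_m) (v : V) : open U ->
  smooth_on U F -> smooth_on U (fun y => F y *m v).
Proof.
move=> Uo hF.
(* The formula holds on [U] only; openness lets it be differentiated once more. *)
have E vs y : U y -> iter_derive vs (fun y => F y *m v) y = iter_derive vs F y *m v.
  elim: vs y => [//|u vs IH] y Uy /=.
  rewrite (near_eq_derive _ (near_open Uo Uy IH)).
  by have [_ dF] := hF vs y Uy; have [_ ->] := is_derive_mulmxr v (dF u).
move=> vs x Ux; have [cF dF] := hF vs x Ux.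
have nE : \near x, iter_derive vs F x *m v = iter_derive vs (fun y => F y *m v) x.
  by apply: (near_open Uo Ux) => y Uy; rewrite E.
split=> [|u].
  have h : ((fun A => A *m v) \o iter_derive vs F) @ x --> iter_derive vs F x *m v.
    by apply: continuous_cvg; [exact: (nbhs_filter x) | exact: continuous_mulmxr | exact: cF].
  rewrite -[X in _ --> X](E vs x Ux) in h.
  exact: cvg_trans (near_eq_cvg nE) h.
apply: near_eq_derivable nE _.
by have [] := is_derive_mulmxr v (dF u).
Qed.

Lemma derivable_formv (W : V -> 'M[R]_m) (F H : V -> V) (x u : V) :
  derivable W x u -> derivable F x u -> derivable H x u ->
  derivable (fun y => formv (W y) (F y) (H y)) x u.
Proof.
move=> /derivable_mxP dW /derivable_mxP dF /derivable_mxP dH.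
rewrite (_ : (fun y => _) = \sum_(j < m)
  (\sum_(i < m) (fun y => F y i 0) * (fun y => W y i j)) * (fun y => H y j 0)).
  apply: derivable_sum => j; apply: derivableM => //.
  by apply: derivable_sum => i; apply: derivableM.
apply/funext => y; rewrite /formv mxE fct_sumE; apply: eq_bigr => j _.
rewrite [RHS]/(_ * _) /= mxE fct_sumE; congr (_ * _).
by apply: eq_bigr => i _; rewrite mxE.
Qed.

Lemma iter_derive_cst (W : normedModType R) (vs : seq V) (c : W) :
  exists c', iter_derive vs (fun _ : V => c) = fun _ => c'.
Proof.
elim: vs => [|u vs [c' IH]]; first by exists c.
exists 0; rewrite /= IH; apply/funext => x; exact: derive_cst.
Qed.

Lemma smooth_on_cst (W : normedModType R) (U : set V) (c : W) :
  smooth_on U (fun _ : V => c).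
Proof.
move=> vs x _; have [c' ->] := iter_derive_cst vs c.
by split=> [|u]; [exact: cst_continuous | exact: derivable_cst].
Qed.

End Smooth.

(** * Torsion and bracket in terms of Christoffel symbols *)

Section PointwiseCalculus.
Variables (R : realType) (m : nat).
Local Notation V := 'cV[R]_m.
Variable G : V -> V -> V -> V.
Implicit Types X Y Z : V -> V.

Lemma torsionE X Y x : torsion G X Y x = G x (X x) (Y x) - G x (Y x) (X x).
Proof.
rewrite /torsion /cov /bracket; apply/colP => i; rewrite !mxE; ring.
Qed.

Lemma torsion_atE x u v : torsion_at G x u v = G x u v - G x v u.
Proof. by rewrite /torsion_at torsionE. Qed.

Lemma bracketE X Y x : bracket X Y x = cov G X Y x - cov G Y X x - torsion G X Y x.
Proof. by rewrite /torsion opprB addrC subrK. Qed.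

End PointwiseCalculus.

(** * The difference of the canonical and Obata connections, and integrability *)

Section Geometry.
Variables (R : realType) (n : nat).
Variable M : smooth_manifold R (4 * n).
Variables (J : 'I_3 -> endo_field M) (w : charts M -> 'cV[R]_(4 * n) -> 'M[R]_(4 * n)).
Hypotheses (hJ : almost_hypercomplex J) (hw : scalar_2form J w).
Local Notation V := 'cV[R]_(4 * n).

Lemma img_open (i : charts M) : open (img i : set V).
Proof. exact: coord_open. Qed.

Lemma fields_quaternionic (i : charts M) x : img i x -> quaternionic (fun a => J a i x).
Proof.
move=> hx; case: hJ => hac hq; have [h1 h2] := hq i x hx.
split=> // [a|]; first by have [_] := hac a; apply.
by rewrite -h2 opprK.
Qed.

Lemma fields_skew_hermitian (i : charts M) x : img i x ->
  skew_hermitian (fun a => J a i x) (w i x).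
Proof.
move=> hx; case: hw => -[_ h _] _ h'; split=> *.
  by rewrite -!formvE; exact: h.
by rewrite -!formvE; exact: h'.
Qed.

Section Canonical.
Variables (G GH : christoffel M).
Hypotheses (hG : is_connection G) (hGH : obata_connection J GH).
Hypothesis hA : forall (i : charts M) (X Y Z : V -> V),
  smooth_on (img i) X -> smooth_on (img i) Y -> smooth_on (img i) Z ->
  forall x, img i x ->
    formv (w i x) (cov (G i) X Y x - cov (GH i) X Y x) (Z x) =
    2^-1 * cov_form (GH i) (w i) X Y Z x.

Variables (i : charts M) (x : V).
Hypothesis hx : img i x.

Let A u v := G i x u v - GH i x u v.

Lemma cov_sub (X Y : V -> V) : cov (G i) X Y x - cov (GH i) X Y x = A (X x) (Y x).
Proof. by rewrite /cov opprD addrACA subrr add0r. Qed.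

Let cst_smooth (u : V) : smooth_on (img i) (fun _ : V => u).
Proof. exact: smooth_on_cst. Qed.

Lemma difference_bilinear2 : bilinear2 A.
Proof.
have [h1 _ _] := hG; have [[h2 _ _] _ _] := hGH.
have [l1 r1] := h1 i x hx; have [l2 r2] := h2 i x hx.
split=> a u u' v; rewrite /A.
  by rewrite l1 l2 scalerBr opprD addrACA.
by rewrite r1 r2 scalerBr opprD addrACA.
Qed.

Lemma difference_form (X Y Z : V -> V) :
  smooth_on (img i) X -> smooth_on (img i) Y -> smooth_on (img i) Z ->
  formv (w i x) (A (X x) (Y x)) (Z x) = 2^-1 * cov_form (GH i) (w i) X Y Z x.
Proof. by move=> sX sY sZ; rewrite -cov_sub hA. Qed.

Lemma derive_opp_near (f f' : V -> R) (u : V) :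
  (forall y, img i y -> f y = - f' y) -> derivable f' x u -> 'D_u f x = - 'D_u f' x.
Proof.
move=> h df; rewrite (near_eq_derive _ (near_open (@img_open i) hx h)).
by rewrite deriveN.
Qed.

Lemma smooth_derivable (W : normedModType R) (U : set V) (f : V -> W) (u : V) :
  smooth_on U f -> U x -> derivable f x u.
Proof. by move=> sf Ux; have [_] := sf [::] x Ux; apply. Qed.

Lemma w_derivable u : derivable (w i) x u.
Proof. by case: hw => -[sw _ _] _ _; exact: smooth_derivable (sw i) hx. Qed.

(** The covariant derivative of a 2-form is again a 2-form in its last two arguments; constant test
    fields suffice, as [A] is pointwise. *)
Lemma difference_form_skew : form_skew (w i x) A.
Proof.
move=> u v z; rewrite -!formvE.
rewrite (difference_form (cst_smooth u) (cst_smooth v) (cst_smooth z)).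
rewrite (difference_form (cst_smooth u) (cst_smooth z) (cst_smooth v)).
rewrite -mulrN; congr (_ * _); rewrite /cov_form.
have [[_ sk _] _ _] := hw.
rewrite (@derive_opp_near _ (fun y => formv (w i y) z v)); first last.
- apply: derivable_formv; [exact: w_derivable|exact: derivable_cst|exact: derivable_cst].
- by move=> y hy; exact: sk.
rewrite (sk i x _ z hx) (sk i x v _ hx); ring.
Qed.

Lemma J_derivable a u : derivable (J a i) x u.
Proof. by case: hJ => h _; have [[sJ _] _] := h a; exact: smooth_derivable (sJ i) hx. Qed.

(** The Obata connection preserves [J a], so its covariant derivative of [w] inherits from [w] the
    sign rule for moving [J a] across; nondegeneracy of [w] turns this rule into commutation. *)
Lemma difference_quaternion_linear : quaternion_linear (fun a => J a i x) A.
Proof.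
move=> a u v; have [hac _] := hJ; have [[sJ _] _] := hac a.
have [_ wu _] := hw; have sk := fields_skew_hermitian hx.
have sJv (v' : V) : smooth_on (img i) (fun y => J a i y *m v').
  exact: (@smooth_on_mulmxr _ _ (img i) (J a i) v' (@img_open i) (sJ i)).
apply: (bform_inj (wu i x hx)) => z.
rewrite (bJl (fields_quaternionic hx) sk a) -!formvE.
rewrite (difference_form (cst_smooth u) (sJv v) (cst_smooth z)).
rewrite (difference_form (cst_smooth u) (cst_smooth v) (sJv z)).
rewrite -mulrN; congr (_ * _); rewrite /cov_form.
have [_ pJ _] := hGH.
rewrite (pJ a i _ _ (cst_smooth u) (cst_smooth v) x hx).
rewrite (pJ a i _ _ (cst_smooth u) (cst_smooth z) x hx).
have wJ y p q : img i y -> formv (w i y) (J a i y *m p) q = - formv (w i y) p (J a i y *m q).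
  by move=> hy; rewrite !formvE (bJl (fields_quaternionic hy) (fields_skew_hermitian hy) a).
rewrite (@derive_opp_near _ (fun y => formv (w i y) v (J a i y *m z))); first last.
- apply: derivable_formv; [exact: w_derivable|exact: derivable_cst|].
  by have [] := is_derive_mulmxr z (@J_derivable a u).
- by move=> y hy; exact: wJ.
rewrite !wJ //; ring.
Qed.

Lemma torsion_delta : (forall u v, torsion_at (GH i) x u v = 0) ->
  torsion_at (G i) x = delta A.
Proof.
move=> t0; apply/funext => u; apply/funext => v.
have := t0 u v; rewrite !torsion_atE /delta /A => /eqP; rewrite subr_eq0 => /eqP ->.
by apply/colP => k; rewrite !mxE; ring.
Qed.

Lemma G_preserves a (X Y : V -> V) : smooth_on (img i) X -> smooth_on (img i) Y ->
  cov (G i) X (app_endo (J a i) Y) x = J a i x *m cov (G i) X Y x.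
Proof.
move=> sX sY; have [_ pJ _] := hGH.
have E Z : cov (G i) X Z x = cov (GH i) X Z x + A (X x) (Z x).
  by rewrite -cov_sub addrC subrK.
rewrite !E (pJ a i _ _ sX sY x hx) [RHS]mulmxDr; congr (_ + _).
exact: difference_quaternion_linear.
Qed.

(* [T = delta B] with [B] commuting with [J] makes [G - B] a torsion-free
   connection preserving [J] at the point x. *)
Lemma nijenhuis_eq0 a (B : V -> V -> V) (X Y : V -> V) :
  smooth_on (img i) X -> smooth_on (img i) Y ->
  (forall u v, torsion_at (G i) x u v = delta B u v) ->
  quaternion_linear (fun a => J a i x) B ->
  nijenhuis (J a i) X Y x = 0.
Proof.
move=> sX sY hB BJ; have q := fields_quaternionic hx.
have tE X' Y' : torsion (G i) X' Y' x = delta B (X' x) (Y' x).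
  by rewrite torsionE -hB torsion_atE.
have cJ X' Y' : smooth_on (img i) Y' ->
    cov (G i) X' (app_endo (J a i) Y') x = J a i x *m cov (G i) X' Y' x.
  (* Only the value of the direction field at [x] matters. Freezing it allows [X'] to be
     [app_endo (J a i) X] without a smoothness proof. *)
  move=> sY'; have cE Z : cov (G i) X' Z x = cov (G i) (fun _ => X' x) Z x by [].
  have h := @G_preserves a (fun _ => X' x) Y' (cst_smooth (X' x)) sY'.
  rewrite [LHS]cE.
  rewrite cE.
  exact: h.
pose K := J a i x; pose JX := app_endo (J a i) X; pose JY := app_endo (J a i) Y.
pose p := cov (G i) JX Y x; pose q' := cov (G i) JY X x.
pose c := cov (G i) X Y x; pose d := cov (G i) Y X x.
pose b1 := B (JX x) (Y x); pose b2 := B (JY x) (X x).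
pose b3 := B (X x) (Y x); pose b4 := B (Y x) (X x).
have e1 : bracket JX JY x = K *m p - K *m q' - (K *m b1 - K *m b2).
  by rewrite (bracketE (G i)) tE (cJ _ _ sX) (cJ _ _ sY) /delta -!BJ.
have e2 : bracket X Y x = c - d - (b3 - b4) by rewrite (bracketE (G i)) tE.
have e3 : bracket JX Y x = p - K *m d - (b1 - K *m b4).
  by rewrite (bracketE (G i)) tE (cJ _ _ sX) /delta -!BJ.
have e4 : bracket X JY x = K *m c - q' - (K *m b3 - b2).
  by rewrite (bracketE (G i)) tE (cJ _ _ sY) /delta -!BJ.
rewrite /nijenhuis e1 e2 e3 e4 -/K.
have KK (z : V) : K *m (K *m z) = - z by exact: JK q a z.
move: p q' c d b1 b2 b3 b4 {e1 e2 e3 e4} => p q' c d b1 b2 b3 b4.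
rewrite !mulmxBr !KK; move: (K *m p) (K *m q') (K *m b1) (K *m b2) => *.
by apply/colP => k; rewrite !mxE; ring.
Qed.

End Canonical.
End Geometry.

Lemma in_sum_delta_commuting (R : realType) (n : nat) (J : 'I_3 -> 'M[R]_(4 * n))
    (w : 'M[R]_(4 * n)) t :
  in_sum J w [:: 3; 4; 5; 7]%N t -> delta_commuting J t.
Proof.
case=> s [hs ht].
have d k (hk : k \in [:: 3; 4; 5; 7]%N) := X_delta_commuting hk (hs k hk).
have d34 := delta_commuting_add (d 3%N isT) (d 4%N isT) (fun u v => erefl).
have d57 := delta_commuting_add (d 5%N isT) (d 7%N isT) (fun u v => erefl).
apply: (delta_commuting_add d34 d57) => u v.
by rewrite ht !big_cons big_nil addr0 addrA.
Qed.

Theorem theorem1p8 (R : realType) (n : nat) (hn : (1 < n)%N)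
    (M : smooth_manifold R (4 * n)) (hM : connected [set: M])
    (J : 'I_3 -> endo_field M)
    (w : charts M -> 'cV[R]_(4 * n) -> 'M[R]_(4 * n))
    (hJ : almost_hypercomplex J) (hw : scalar_2form J w)
    (G : christoffel M) (hG : canonical_connection J w G) :
  (hypercomplex J <-> of_type J w G [:: 3; 4; 5; 7]%N) /\
  (of_type J w G [:: 3; 4; 5; 7]%N <->
   [/\ torsion_component_vanishes J w G 1,
       torsion_component_vanishes J w G 2
     & torsion_component_vanishes J w G 6]).
Proof.
have n_gt0 : (0 < n)%N := ltnW hn.
case: hG => cG [GH oGH hA].
have wu i x : img i x -> w i x \in unitmx by case: hw => _ h _; exact: h.
split; split=> H.
- move=> i x hx; have t0 u v : torsion_at (GH i) x u v = 0.
    have [_ _ hT] := oGH; have sc (v' : 'cV[R]_(4 * n)) : smooth_on (img i) (fun _ => v').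
      exact: smooth_on_cst.
    rewrite /torsion_at (hT i _ _ (sc u) (sc v) x hx).
    rewrite big1 ?scaler0 // => a _; exact: (H a i _ _ (sc u) (sc v) x hx).
  rewrite (torsion_delta G t0); apply: delta_in_sum => //.
  - exact: fields_quaternionic.
  - exact: fields_skew_hermitian.
  - exact: wu.
  split.
  - exact: (difference_bilinear2 cG oGH).
  - exact: (difference_quaternion_linear hJ hw oGH hA).
  - exact: (difference_form_skew hw hA).
- move=> a i X Y sX sY x hx.
  have [B [_ BJ tB]] := in_sum_delta_commuting (H i x hx).
  exact: (nijenhuis_eq0 hJ hw oGH hA hx a sX sY tB BJ).
- by split=> i x hx; have [] := in_sum_components_vanish (H i x hx).
- case: H => H1 H2 H6 i x hx; apply: components_vanish_in_sum => //.
  - exact: fields_quaternionic.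
  - exact: fields_skew_hermitian.
  - exact: wu.
  - exact: H1.
  - exact: H2.
  - exact: H6.
Qed.
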